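(* Let $E$ and $F$ be two graphs of Gelfand-Kirillov dimension three, and let $E'$ and $F'$ be graphs in normal form obtained from $E$ and $F$, respectively, using in-splittings, out-splittings, in-amalgamations and out-amalgamations. Then $A_E$ and $A_F$ are strong shift equivalent if and only if $E'\approx F'$.
   Context: A graph $E=(E^0,E^1,r,s)$ consists of a vertex set, an edge set and source and range maps $s,r:E^1\to E^0$. A finite graph is essential if every vertex emits an edge and receives an edge. The adjacency matrix is $A_E(v,w)=|s^{-1}(v)\cap r^{-1}(w)|$. Square nonnegative integer matrices $A,B$ are elementary shift equivalent if $A=RS$, $B=SR$ for some nonnegative integer matrices $R,S$; they are strong shift equivalent if they are joined by a finite sequence of elementary shift equivalences. In-splitting (for graphs without sources): for each $v\in E^0$ choose a partition $\{\mathscr{E}^v_1,\dots,\mathscr{E}^v_{m(v)}\}$ of $r^{-1}(v)$ into nonempty sets. The in-splitting $G$ of $E$ has $G^0=\{v_i\mid v\in E^0,1\le i\le m(v)\}$, $G^1=\{e_j\mid e\in E^1,1\le j\le m(s(e))\}$, with $s(e_j)=s(e)_j$ and $r(e_j)=r(e)_i$ where $e\in\mathscr{E}^{r(e)}_i$. Then $E$ is called an in-amalgamation of $G$. A graph $G$ is an out-splitting (out-amalgamation) of $E$ if the transpose graph $G^*$ (sources and ranges interchanged) is an in-splitting (in-amalgamation) of $E^*$. A path is a string $e_1\cdots e_n$ of edges with $r(e_i)=s(e_{i+1})$; a cycle is a closed path of positive length $e_1\cdots e_n$ with $s(e_1),\dots,s(e_n)$ distinct (considered up to choice of base vertex). A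 graph of Gelfand-Kirillov dimension three is a connected finite essential graph whose Leavitt path algebra $L_K(E)$ has Gelfand-Kirillov dimension $3$ (independent of the field $K$); equivalently, $E$ is a connected finite essential graph consisting of pairwise disjoint cycles $C_1^E,\dots,C_m^E$ (the source cycles) and $D_1^E,\dots,D_n^E$ (the sink cycles), $m,n\ge1$, which are all the cycles of $E$, together with paths leading from source cycles to sink cycles; no edge enters a source cycle from outside it, no edge leaves a sink cycle, and every vertex not on a cycle lies on a path from some source cycle to some sink cycle. A trail is a path $p=e_1\cdots e_t$ with $s(p)$ on a source cycle, $r(p)$ on a sink cycle, and $r(e_k)$ on none of the source or sink cycles for $1\le k<t$. A graph $E$ of Gelfand-Kirillov dimension three is in normal form if every trail consists of exactly one edge and, for each source cycle, all trails starting from it have the same source; denote by $v_i^E$ the common source of the trails starting from $C_i^E$. Let $p_i^E=|C_i^E|$, $q_j^E=|D_j^E|$ (lengths), $d_{(i,j)}^E=\gcd(p_i^E,q_j^E)$. The vertices of each cycle of length $\ell$ are indexed consecutively along the direction of the edges by the integers $1,\dots,\ell$ (read modulo $\ell$). For an integer $c$, $N_{(i,j)}^E(c)$ is the number of trails of $E$ starting at $v_i^E$ and ending at a vertex of $D_j^E$ whose index $l$ satisfies $l\equiv c \pmod{d_{(i,j)}^E}$. For graphs $E,F$ of Gelfand-Kirillov dimension three in normal form, $E\approx F$ means that $E$ and $F$ have the same number $m$ of source cycles and the same number $n$ of sink cycles, and that for suitable numberings $C_1^E,\dots,C_m^E$, $D_1^E,\dots,D_n^E$ and $C_1^F,\dots,C_m^F$,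 $D_1^F,\dots,D_n^F$ of these cycles there are integers $a_1,\dots,a_m,b_1,\dots,b_n$ such that $p_i^E=p_i^F$, $q_j^E=q_j^F$ and $N_{(i,j)}^E(c)=N_{(i,j)}^F(c+a_i+b_j)$ for all $c\in\mathbb{N}$, $1\le i\le m$, $1\le j\le n$. *)

(* Defs.v *)
From HB Require Import structures.
From mathcomp Require Import all_boot all_order all_algebra.
From Stdlib Require Import Relation_Operators.

Set Implicit Arguments.
Unset Strict Implicit.
Unset Printing Implicit Defensive.

Import GRing.Theory.

(** * Finite directed multigraphs *)

Record graph := Graph {
  vertex : finType;
  edge : finType;
  src : edge -> vertex;
  rng : edge -> vertex }.

Definition transpose (E : graph) : graph := Graph (@rng E) (@src E).

Definition no_sources (E : graph) : Prop :=
  forall v : vertex E, exists e : edge E, rng e = v.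

Definition essential (E : graph) : Prop :=
  forall v : vertex E,
    (exists e : edge E, src e = v) /\ (exists e : edge E, rng e = v).

Definition adj (E : graph) : rel (vertex E) :=
  fun v w => [exists e : edge E, (src e == v) && (rng e == w)].

(* Connected: joined by paths that may traverse edges in either direction. *)
Definition connected (E : graph) : Prop :=
  forall v w : vertex E, connect (fun x y => adj x y || adj y x) v w.

Definition graph_iso (E F : graph) : Prop :=
  exists (f : vertex E -> vertex F) (g : edge E -> edge F),
    [/\ bijective f, bijective g,
        forall e, src (g e) = f (src e) & forall e, rng (g e) = f (rng e)].

(** * Strong shift equivalence *)

(* Rows and columns follow the enumeration of the vertex type. *)
Definition adjacency (E : graph) : 'M[nat]_#|vertex E| :=
  \matrix_(i, j) #|[set e : edge E |
                     (src e == enum_val i) && (rng e == enum_val j)]|.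

Definition elementary_shift_equivalent (n m : nat)
    (A : 'M[nat]_n) (B : 'M[nat]_m) : Prop :=
  exists (R : 'M[nat]_(n, m)) (S : 'M[nat]_(m, n)),
    A = (R *m S)%R /\ B = (S *m R)%R.

(* The matrices along the chain may have different sizes. *)
Inductive strong_shift_equivalent (n : nat) (A : 'M[nat]_n) :
    forall m : nat, 'M[nat]_m -> Prop :=
| sse_refl : strong_shift_equivalent A A
| sse_step (m k : nat) (B : 'M[nat]_m) (C : 'M[nat]_k) :
    strong_shift_equivalent A B -> elementary_shift_equivalent B C ->
    strong_shift_equivalent A C.

(** * Splittings and amalgamations *)

(* A partition of r^{-1}(v) into m(v) labelled classes, for all v at once, is
   given by the label [cls e] of the class of r^{-1}(r(e)) containing [e].  The
   vertex v_i is the pair (v, i) and the edge e_j is the pair (e, j). *)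
Definition in_split (E : graph) (m : vertex E -> nat)
    (cls : forall e : edge E, 'I_(m (rng e))) : graph :=
  @Graph {v : vertex E & 'I_(m v)} {e : edge E & 'I_(m (src e))}
    (fun x => Tagged (fun v => 'I_(m v)) (tagged x))
    (fun x => Tagged (fun v => 'I_(m v)) (cls (tag x))).

Definition classes_nonempty (E : graph) (m : vertex E -> nat)
    (cls : forall e : edge E, 'I_(m (rng e))) : Prop :=
  forall x : {v : vertex E & 'I_(m v)},
    exists e : edge E, Tagged (fun v => 'I_(m v)) (cls e) = x.

Definition in_splitting (G E : graph) : Prop :=
  no_sources E /\
  exists (m : vertex E -> nat) (cls : forall e : edge E, 'I_(m (rng e))),
    classes_nonempty cls /\ graph_iso G (in_split cls).

Definition out_splitting (G E : graph) : Prop :=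
  in_splitting (transpose G) (transpose E).

Definition in_amalgamation (E G : graph) : Prop := in_splitting G E.

Definition out_amalgamation (E G : graph) : Prop :=
  in_amalgamation (transpose E) (transpose G).

Definition move (E F : graph) : Prop :=
  [\/ in_splitting F E, out_splitting F E,
      in_amalgamation F E | out_amalgamation F E].

Definition obtained_from (F E : graph) : Prop := clos_refl_trans graph move E F.

(** * Graphs of Gelfand-Kirillov dimension three *)

Definition consecutive (E : graph) : rel (edge E) :=
  fun e f => rng e == src f.

Definition is_cycle (E : graph) (c : seq (edge E)) : bool :=
  [&& c != [::], path.cycle (@consecutive E) c & uniq (map (@src E) c)].

Definition cycle_vertices (E : graph) (c : seq (edge E)) : seq (vertex E) :=
  map (@src E) c.

(* A cycle is only defined up to its base vertex; the edge sequences below also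
   record a base vertex for each cycle. *)
Record cycle_numbering (E : graph) (m n : nat) := CycleNumbering {
  source_cycle : 'I_m -> seq (edge E);
  sink_cycle : 'I_n -> seq (edge E) }.

Definition on_source_cycle (E : graph) (m n : nat)
    (d : cycle_numbering E m n) (v : vertex E) : bool :=
  [exists i, v \in cycle_vertices (source_cycle d i)].

Definition on_sink_cycle (E : graph) (m n : nat)
    (d : cycle_numbering E m n) (v : vertex E) : bool :=
  [exists j, v \in cycle_vertices (sink_cycle d j)].

Record source_sink_structure (E : graph) (m n : nat)
    (d : cycle_numbering E m n) : Prop := SourceSinkStructure {
  source_count_gt0 : 0 < m;
  sink_count_gt0 : 0 < n;
  source_cycleP : forall i, is_cycle (source_cycle d i);
  sink_cycleP : forall j, is_cycle (sink_cycle d j);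
  source_source_disjoint : forall i i' v,
    v \in cycle_vertices (source_cycle d i) ->
    v \in cycle_vertices (source_cycle d i') -> i = i';
  sink_sink_disjoint : forall j j' v,
    v \in cycle_vertices (sink_cycle d j) ->
    v \in cycle_vertices (sink_cycle d j') -> j = j';
  source_sink_disjoint : forall v, ~~ (on_source_cycle d v && on_sink_cycle d v);
  all_cycles : forall c, is_cycle c ->
    (exists i k, c = rot k (source_cycle d i)) \/
    (exists j k, c = rot k (sink_cycle d j));
  source_no_entry : forall i (e : edge E),
    rng e \in cycle_vertices (source_cycle d i) ->
    src e \in cycle_vertices (source_cycle d i);
  sink_no_exit : forall j (e : edge E),
    src e \in cycle_vertices (sink_cycle d j) ->
    rng e \in cycle_vertices (sink_cycle d j);
  off_cycle_vertex : forall v,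
    ~~ on_source_cycle d v -> ~~ on_sink_cycle d v ->
    exists u w, [/\ on_source_cycle d u, on_sink_cycle d w,
                    connect (@adj E) u v & connect (@adj E) v w] }.

(* By the Alahmadi-Alsulami-Jain-Zelmanov theorem these are exactly the
   connected finite essential graphs whose Leavitt path algebra, over any field,
   has Gelfand-Kirillov dimension 3. *)
Definition gk_dim_three (E : graph) : Prop :=
  [/\ connected E, essential E &
      exists (m n : nat) (d : cycle_numbering E m n), source_sink_structure d].

(** * Trails and normal form *)

Definition is_trail (E : graph) (m n : nat) (d : cycle_numbering E m n)
    (p : seq (edge E)) : bool :=
  if p is e :: q then
    [&& path (@consecutive E) e q,
        on_source_cycle d (src e),
        on_sink_cycle d (rng (last e q)) &
        all (fun f => ~~ on_source_cycle d (rng f) && ~~ on_sink_cycle d (rng f))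
          (belast e q)]
  else false.

Definition trail_starts_at (E : graph) (m n : nat) (d : cycle_numbering E m n)
    (v : vertex E) (p : seq (edge E)) : Prop :=
  is_trail d p /\ ohead (map (@src E) p) = Some v.

(* The structure [d] is unique up to renumbering and change of base vertices,
   neither of which affects the two conditions on trails. *)
Definition normal_form (E : graph) : Prop :=
  gk_dim_three E /\
  exists (m n : nat) (d : cycle_numbering E m n),
    [/\ source_sink_structure d,
        forall p, is_trail d p -> size p = 1 &
        forall i v w p q,
          v \in cycle_vertices (source_cycle d i) ->
          w \in cycle_vertices (source_cycle d i) ->
          trail_starts_at d v p -> trail_starts_at d w q -> v = w].

(** * The relation on normal forms *)

Definition is_common_trail_source (E : graph) (m n : nat)
    (d : cycle_numbering E m n) (i : 'I_m) (v : vertex E) : Prop :=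
  [/\ v \in cycle_vertices (source_cycle d i),
      exists p, trail_starts_at d v p &
      forall w p, w \in cycle_vertices (source_cycle d i) ->
        trail_starts_at d w p -> w = v].

(* Indices run over 1, ..., l, starting at the base vertex. *)
Definition cycle_index (E : graph) (c : seq (edge E)) (v : vertex E) : nat :=
  (index v (cycle_vertices c)).+1.

Definition cycle_gcd (E : graph) (m n : nat) (d : cycle_numbering E m n)
    (i : 'I_m) (j : 'I_n) : nat :=
  gcdn (size (source_cycle d i)) (size (sink_cycle d j)).

(* In a graph in normal form a trail is a single edge, so trails are counted as
   edges; [v i] stands for the common source of the trails from the i-th source
   cycle. *)
Definition trail_count (E : graph) (m n : nat) (d : cycle_numbering E m n)
    (v : 'I_m -> vertex E) (i : 'I_m) (j : 'I_n) (c : int) : nat :=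
  #|[set e : edge E |
      [&& is_trail d [:: e], src e == v i,
          rng e \in cycle_vertices (sink_cycle d j) &
          ((cycle_index (sink_cycle d j) (rng e))%:Z
             == c %[mod (cycle_gcd d i j)%:Z])%Z]]|.

Definition nf_equiv (E F : graph) : Prop :=
  exists (m n : nat) (dE : cycle_numbering E m n) (dF : cycle_numbering F m n)
         (vE : 'I_m -> vertex E) (vF : 'I_m -> vertex F)
         (a : 'I_m -> int) (b : 'I_n -> int),
    [/\ source_sink_structure dE /\ source_sink_structure dF,
        forall i, is_common_trail_source dE i (vE i) /\
                  is_common_trail_source dF i (vF i),
        forall i, size (source_cycle dE i) = size (source_cycle dF i),
        forall j, size (sink_cycle dE j) = size (sink_cycle dF j) &
        forall (c : nat) i j,
          trail_count dE vE i j c%:Z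
          = trail_count dF vF i j (c%:Z + a i + b j)%R].

(* Main.v *)
(**
A splitting factors the adjacency matrix as R S with S R the new one, so E, F
may be replaced by E', F'.  Every vertex of a graph in normal form lies on a
cycle, so its adjacency matrix is P + X, with P the permutation matrix of the
successor map s along the cycles and X the source-to-sink trail matrix.

If P + X and Q + Y are strong shift equivalent, they are intertwined by
nonnegative matrices R, S whose products are powers of them.  The intertwining
relation forbids R to lead from a sink to a source, and R is then a permutation
matrix between the sinks and between the sources.  This identifies the cycles
of both graphs, and the source-to-sink block T of R satisfies
T(s v, s x) + X(v, s x) = Y(v, s x) + T(v, x).  Summing over all pairs (v, x) on
a given pair of cycles with a given index difference modulo the gcd of the
lengths cancels T, which leaves the equality of the numbers of trails.

Conversely, one elementary shift equivalence moves a single trail from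
(s v, s x) to (v, x).  By the Chinese remainder theorem, the orbits of these
moves are exactly the classes of pairs with the same index difference modulo the
gcd, so the trails of the two graphs can be matched and moved onto each other.
*)

Require Import Defs.
From mathcomp Require Import all_boot all_order all_algebra.
From Stdlib Require Import Relation_Operators.
From mathcomp Require Import ring.

Set Implicit Arguments.
Unset Strict Implicit.
Unset Printing Implicit Defensive.

Import GRing.Theory.

(** * Strong shift equivalence and moves *)

Lemma ese_sym n m (A : 'M[nat]_n) (B : 'M[nat]_m) :
  elementary_shift_equivalent A B -> elementary_shift_equivalent B A.
Proof. by case=> R [S [-> ->]]; exists S, R. Qed.

Lemma ese_sse n m (A : 'M[nat]_n) (B : 'M[nat]_m) :
  elementary_shift_equivalent A B -> strong_shift_equivalent A B.
Proof. exact: (sse_step (sse_refl A)). Qed.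

Lemma sse_trans n m k (A : 'M[nat]_n) (B : 'M[nat]_m) (C : 'M[nat]_k) :
  strong_shift_equivalent A B -> strong_shift_equivalent B C ->
  strong_shift_equivalent A C.
Proof.
move=> AB BC; elim: BC AB => // k1 k2 D F _ IH DF AB.
exact: sse_step (IH AB) DF.
Qed.

Lemma sse_sym n m (A : 'M[nat]_n) (B : 'M[nat]_m) :
  strong_shift_equivalent A B -> strong_shift_equivalent B A.
Proof.
elim=> [|k1 k2 D F _ IH DF]; first exact: sse_refl.
by apply: sse_trans IH; apply/ese_sse/ese_sym.
Qed.

(** This is Williams' shift equivalence of lag [l] over the nonnegative integers. It replaces a
    chain of factorisations by one pair of matrices, to which positivity arguments apply. *)
Definition shift_equivalent n m (A : 'M[nat]_n) (B : 'M[nat]_m) : Prop :=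
  exists (R : 'M[nat]_(n, m)) (S : 'M[nat]_(m, n)) (l : nat),
    [/\ A *m R = R *m B, S *m A = B *m S, R *m S = A ^+ l & S *m R = B ^+ l]%R.

Lemma exprmx_comm n m (A : 'M[nat]_n) (B : 'M[nat]_m) (R : 'M[nat]_(n, m)) l :
  (A *m R = R *m B -> A ^+ l *m R = R *m B ^+ l)%R.
Proof.
move=> AR; elim: l => [|l IH]; first by rewrite !expr0 mul1mx mulmx1.
by rewrite !exprSr -!mulmxE -mulmxA AR mulmxA IH mulmxA.
Qed.

(** A further step D = P Q, F = Q P is absorbed by multiplying the intertwiners by P and Q, which
    raises the lag by one. *)
Lemma sse_shift_equivalent n m (A : 'M[nat]_n) (B : 'M[nat]_m) :
  strong_shift_equivalent A B -> shift_equivalent A B.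
Proof.
elim=> [|k1 k2 D F _ [R [S [l [AR SA RS SR]]]] [P [Q [DE FE]]]].
  by exists 1%:M%R, 1%:M%R, 0; rewrite !mul1mx mulmx1 expr0.
have DP : (D *m P = P *m F)%R by rewrite DE FE mulmxA.
have QD : (Q *m D = F *m Q)%R by rewrite DE FE mulmxA.
exists (R *m P)%R, (Q *m S)%R, l.+1; split.
- by rewrite mulmxA AR -!mulmxA DP.
- by rewrite -mulmxA SA !mulmxA QD.
- by rewrite mulmxA -(mulmxA R) -DE -AR -mulmxA RS exprS.
- by rewrite mulmxA -(mulmxA Q) SR -(exprmx_comm l (esym QD)) -mulmxA -FE
    exprSr.
Qed.

(** * Matrices indexed by finite types *)

Section FunctionMatrices.
Implicit Types V W U : finType.

(** The size stays [#|V|], as in [adjacency], while entries and products are computed over the types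
    themselves. *)
Definition mxf V W (f : V -> W -> nat) : 'M[nat]_(#|V|, #|W|) :=
  \matrix_(i, j) f (enum_val i) (enum_val j).

Lemma mxfE V W (f : V -> W -> nat) v w :
  mxf f (enum_rank v) (enum_rank w) = f v w.
Proof. by rewrite mxE !enum_rankK. Qed.

Lemma eq_mxf V W (f g : V -> W -> nat) : f =2 g -> mxf f = mxf g.
Proof. by move=> fg; apply/matrixP => i j; rewrite !mxE fg. Qed.

Lemma mulmx_enum V W U (R : 'M[nat]_(#|V|, #|W|)) (S : 'M[nat]_(#|W|,
  #|U|)) v u :
  (R *m S)%R (enum_rank v) (enum_rank u) =
  \sum_w R (enum_rank v) (enum_rank w) * S (enum_rank w) (enum_rank u).
Proof. by rewrite mxE (reindex _ (onW_bij _ (@enum_rank_bij W))). Qed.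

Lemma mxf_mul V W U (R : V -> W -> nat) (S : W -> U -> nat) :
  (mxf R *m mxf S)%R = mxf (fun v u => \sum_w R v w * S w u).
Proof.
apply/matrixP => i j; rewrite -(enum_valK i) -(enum_valK j) mulmx_enum mxfE.
by apply: eq_bigr => w _; rewrite !mxfE.
Qed.

Lemma mxf_ese V W (f : V -> V -> nat) (g : W -> W -> nat)
    (R : V -> W -> nat) (S : W -> V -> nat) :
  (forall v x, f v x = \sum_w R v w * S w x) ->
  (forall w y, g w y = \sum_v S w v * R v y) ->
  elementary_shift_equivalent (mxf f) (mxf g).
Proof.
by move=> fE gE; exists (mxf R), (mxf S); rewrite !mxf_mul; split;
  apply: eq_mxf.
Qed.

Lemma sum_eq1 V (f : V -> nat) v : \sum_u (u == v) * f u = f v.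
Proof.
rewrite (bigD1 v) //= eqxx mul1n big1 ?addn0 // => u /negPf ->.
by rewrite mul0n.
Qed.

(** The factors are the first matrix with relabelled columns and the permutation matrix of the
    inverse of [h]. *)
Lemma mxf_relabel V W (f : V -> V -> nat) (g : W -> W -> nat) (h : V -> W) :
  bijective h -> (forall v x, f v x = g (h v) (h x)) ->
  strong_shift_equivalent (mxf f) (mxf g).
Proof.
case=> h' hK h'K fg; apply: ese_sse.
apply: (@mxf_ese _ _ _ _ (fun v w => f v (h' w)) (fun w v => (v == h' w) :
  nat)).
- move=> v x; rewrite -[RHS]/(\sum_w f v (h' w) * (x == h' w)).
  rewrite (eq_bigr (fun w => (w == h x) * f v (h' w))) ?sum_eq1 ?hK // => w _.
  by rewrite mulnC -(can2_eq hK h'K) eq_sym.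
- by move=> w y; rewrite sum_eq1 fg !h'K.
Qed.

End FunctionMatrices.

(** * Invariance under splittings and amalgamations *)

Definition edge_count (E : graph) (v w : vertex E) : nat :=
  #|[set e : edge E | (src e == v) && (rng e == w)]|.

Lemma adjacencyE (E : graph) : adjacency E = mxf (@edge_count E).
Proof. by []. Qed.

Lemma iso_sse (E F : graph) :
  graph_iso E F -> strong_shift_equivalent (adjacency E) (adjacency F).
Proof.
case=> f [g [fb gb gs gr]]; rewrite !adjacencyE;
  apply: (mxf_relabel (h := f)) => // v x.
rewrite /edge_count -(card_imset _ (bij_inj gb)); apply: eq_card => e.
have [g' _ g'K] := gb; rewrite -(g'K e) mem_imset; last exact: bij_inj.
by rewrite !inE gs gr !(bij_eq fb).
Qed.

(** [R] counts the edges from a vertex into each class, and [S] sends each copy v_i back to v. In R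
    S the classes are summed over; in S R the edges leaving v_i are the copies e_i of the edges
    leaving v. *)
Lemma in_split_ese (E : graph) m (cls : forall e : edge E, 'I_(m (rng e))) :
  elementary_shift_equivalent (adjacency E) (adjacency (in_split cls)).
Proof.
pose R (v : vertex E) (x : vertex (in_split cls)) : nat :=
  #|[set e | (src e == v) && (Tagged (fun v => 'I_(m v)) (cls e) == x)]|.
pose S (x : vertex (in_split cls)) (v : vertex E) : nat := (v == tag x).
rewrite !adjacencyE; apply: (mxf_ese (R := R) (S := S)) => [v w|x y].
  rewrite /edge_count /R /S -sum1_card.
  rewrite (partition_big (fun e => Tagged (fun v => 'I_(m v)) (cls e)) predT)
    //=.
  apply: eq_bigr => x _; rewrite -sum1_card.
  case: eqP => [->|/eqP wx]; rewrite ?muln1 ?muln0.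
    apply: eq_bigl => e; rewrite !inE -andbA; congr (_ && _).
    by rewrite andb_idl // => /eqP <-.
  rewrite big1 // => e; rewrite !inE => /andP[/andP[_ /eqP re] /eqP ex].
  by rewrite -re -ex eqxx in wx.
rewrite sum_eq1 /edge_count /R; case: x => v i.
(* Forgetting the copy index is injective on edges with a fixed source, because that source
   determines the index. *)
pose f (z : edge (in_split cls)) := tag z.
rewrite -(card_in_imset (f := f)) => [|[e1 i1] [e2 i2]]; last first.
  rewrite /f !inE /= => /andP[/eqP x1 _] /andP[/eqP x2 _] e12.
  case: _ / e12 in i2 x2 *; move: x2; rewrite -x1 => /eqP.
  by rewrite eq_Tagged => /eqP /= ->.
apply: eq_card => e; rewrite [RHS]inE; apply/imsetP/andP => [[z + ->]|[/eqP/= ev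
  ey]].
  by rewrite /f inE => /andP[/eqP/(congr1 tag) /= -> ->].
case: _ / ev in i *; exists (Tagged (fun e => 'I_(m (src e))) i) => //.
by rewrite inE eqxx.
Qed.

Lemma in_splitting_sse (G E : graph) :
  in_splitting G E -> strong_shift_equivalent (adjacency E) (adjacency G).
Proof.
case=> _ [m [cls [_ iso]]]; apply: sse_trans (ese_sse (in_split_ese cls)) _.
exact/sse_sym/iso_sse.
Qed.

Lemma adjacency_transpose (E : graph) :
  adjacency (transpose E) = ((adjacency E)^T)%R.
Proof.
by apply/matrixP => i j; rewrite !mxE; apply: eq_card => e; rewrite !inE andbC.
Qed.

Lemma sse_trmx n m (A : 'M[nat]_n) (B : 'M[nat]_m) :
  strong_shift_equivalent A B -> strong_shift_equivalent A^T%R B^T%R.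
Proof.
elim=> [|k1 k2 D F _ IH [R [S [DE FE]]]]; first exact: sse_refl.
apply: sse_step IH _; exists S^T%R, R^T%R.
by rewrite DE FE !trmx_mul.
Qed.

Lemma out_splitting_sse (G E : graph) :
  out_splitting G E -> strong_shift_equivalent (adjacency E) (adjacency G).
Proof.
move/in_splitting_sse/sse_trmx; rewrite !adjacency_transpose.
by rewrite !trmxK.
Qed.

Lemma move_sse (E F : graph) :
  move E F -> strong_shift_equivalent (adjacency E) (adjacency F).
Proof.
case=> [/in_splitting_sse|/out_splitting_sse|/in_splitting_sse/sse_sym|] //.
by move/out_splitting_sse/sse_sym.
Qed.

Lemma obtained_from_sse (F E : graph) :
  obtained_from F E -> strong_shift_equivalent (adjacency E) (adjacency F).
Proof.
elim=> [G H /move_sse //|G|G H K _ GH _]; first exact: sse_refl.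
exact: sse_trans GH.
Qed.

(** * Permutations with indexed cycles *)

Lemma eqz_mod_shift (d x y : int) :
  (d %| (x - y)%R)%Z -> (d %| x)%Z = (d %| y)%Z.
Proof. by move=> dxy; rewrite -[x in LHS](subrK y) rpredDl. Qed.

(** Each [c t] lists one cycle of [s] from a chosen base point, so that [index] gives the position
    along the cycle. *)
Definition cycle_partition (V I : finType) (c : I -> seq V) (s : V ->
  V) : Prop :=
  [/\ forall v, exists t, v \in c t,
      forall t t' v, v \in c t -> v \in c t' -> t = t',
      forall t, uniq (c t),
      forall t, 0 < size (c t) &
      forall t v, v \in c t -> s v = next (c t) v].

Section CyclePartition.
Variables (V I : finType) (c : I -> seq V) (s : V -> V).
Hypothesis cP : cycle_partition c s.

Lemma cycle_partition_mem t v : (s v \in c t) = (v \in c t).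
Proof.
case: cP => cov dis _ _ sE; have [t' vt'] := cov v.
have svt' : s v \in c t' by rewrite (sE _ _ vt') mem_next.
by apply/idP/idP => /dis E; [rewrite (E _ svt') | rewrite (E _ vt')].
Qed.

Lemma cycle_partition_iter_mem t v k : (iter k s v \in c t) = (v \in c t).
Proof. by elim: k => //= k; rewrite cycle_partition_mem. Qed.

Lemma index_cycle_partition t v : v \in c t ->
  index (s v) (c t) = (index v (c t)).+1 %[mod size (c t)].
Proof.
case: cP => _ _ cU _ sE vt; rewrite (sE _ _ vt) next_nth vt.
have := cU t; have := vt; rewrite -index_mem; case: (c t) => // y p lti yU.
have -> : nth y p (index v (y :: p)) = nth y (y :: p) (index v (y :: p)).+1 by
  [].
move: lti; rewrite leq_eqVlt => /orP[/eqP ->|lti]; last by rewrite index_uniq.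
(* At the last vertex [nth] runs past the end and returns its default, the base point [y], whose
   index 0 is the size modulo the size. *)
by rewrite nth_default // modnn /= eqxx mod0n.
Qed.

Lemma index_iter_cycle_partition t v k : v \in c t ->
  index (iter k s v) (c t) = index v (c t) + k %[mod size (c t)].
Proof.
move=> vt; elim: k => [|k IH]; first by rewrite addn0.
rewrite index_cycle_partition ?cycle_partition_iter_mem //.
by rewrite -addn1 -modnDml IH modnDml addn1 addnS.
Qed.

Lemma index_cycle_partition_inj t v w : v \in c t -> w \in c t ->
  index v (c t) = index w (c t) %[mod size (c t)] -> v = w.
Proof.
move=> vt wt; rewrite !modn_small ?index_mem // => E.
by rewrite -(nth_index v vt) E nth_index.
Qed.

Lemma cycle_partition_iter_exists t v w : v \in c t -> w \in c t ->
  exists k, w = iter k s v.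
Proof.
(* Finish the turn from [v] to the base point, then go on to [w]; this keeps the exponent a natural
   number. *)
move=> vt wt; exists (size (c t) - index v (c t) + index w (c t)).
apply: (@index_cycle_partition_inj t); rewrite ?cycle_partition_iter_mem //.
rewrite index_iter_cycle_partition // addnA subnKC ?modnDl //.
by rewrite ltnW // index_mem.
Qed.

Lemma cycle_partition_inj : injective s.
Proof.
case: (cP) => cov dis _ _ _ v w E; have [t vt] := cov v.
have wt : w \in c t by rewrite -cycle_partition_mem -E cycle_partition_mem.
apply: (index_cycle_partition_inj vt wt); apply/eqP.
rewrite -(eqn_modDr 1) !addn1; apply/eqP.
by rewrite -!index_cycle_partition // E.
Qed.

End CyclePartition.

(** * Rotating cycles onto cycles of equal length *)

Section RotateCycles.
Variables (V W I : finType) (c : I -> seq V) (c' : I -> seq W).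
Variables (s : V -> V) (s' : W -> W) (al : I -> int).
Hypotheses (cP : cycle_partition c s) (cP' : cycle_partition c' s').
Hypothesis size_eq : forall t, size (c t) = size (c' t).

Let rotates (h : V -> W) : Prop := forall t v, v \in c t ->
  h v \in c' t /\
  ((index (h v) (c' t))%:Z = ((index v (c t))%:Z + al t)%R %[mod (size (c
    t))%:Z])%Z.

Lemma rotate_cycles_inj (h : V -> W) : rotates h -> injective h.
Proof.
move=> hP v v' E; case: (cP) => cov dis _ _ _; case: (cP') => _ dis' _ _ _.
have [t vt] := cov v; have [t' vt'] := cov v'.
have [ht hi] := hP _ _ vt; have [ht' hi'] := hP _ _ vt'.
have tt' : t = t' by apply: dis' ht _; rewrite E.
case: _ / tt' in vt' ht' hi'; rewrite -E hi in hi'.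
apply: (index_cycle_partition_inj vt vt'); move/eqP: hi'.
by rewrite eqz_modDr !modz_nat eqz_nat => /eqP.
Qed.

Lemma rotate_cycles_exists : exists h : V -> W, rotates h.
Proof.
suff /fin_all_exists[h hP] v : exists w, forall t, v \in c t -> w \in c' t /\
  ((index w (c' t))%:Z = ((index v (c t))%:Z + al t)%R %[mod (size (c
    t))%:Z])%Z.
  by exists h => t v; exact: hP.
case: (cP) => cov dis _ pos _; case: (cP') => _ _ U' _ _.
have [t vt] := cov v; have := pos t.
(* The target position is an integer residue, since the offset may be negative; it is a valid
   position in [c' t] because the lengths agree. *)
set q := size (c t) => q_gt0; pose x := ((index v (c t))%:Z + al t)%R.
have xge0 : (0 <= x %% q%:Z)%Z%R by rewrite modz_ge0 // eqz_nat -lt0n.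
have xlt : (`|(x %% q%:Z)%Z|%N < size (c' t)).
  by rewrite -size_eq -ltz_nat gez0_abs // ltz_pmod.
have [y yt] : exists y, y \in c' t.
  by case: (c' t) xlt => // y p _; exists y; rewrite inE eqxx.
exists (nth y (c' t) `|(x %% q%:Z)%Z|%N) => t' /(dis _ _ _ vt) <-.
by rewrite mem_nth // index_uniq // gez0_abs // modz_mod.
Qed.

Lemma rotate_cycles_commute (h : V -> W) : rotates h ->
  forall v, h (s v) = s' (h v).
Proof.
move=> hP v; case: (cP) => cov _ _ _ _; have [t vt] := cov v.
have svt : s v \in c t by rewrite cycle_partition_mem.
have [hv hi] := hP _ _ vt; have [hsv hsi] := hP _ _ svt.
apply: (index_cycle_partition_inj hsv).
  by rewrite (cycle_partition_mem cP').
apply/eqP; rewrite (index_cycle_partition cP') // -size_eq -eqz_nat -!modz_nat.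
rewrite hsi -modzDml modz_nat index_cycle_partition // -modz_nat modzDml.
by rewrite !intS -addrA -[eqbRHS]modzDmr hi modzDmr.
Qed.

End RotateCycles.

(** Rotations exist in both directions and are injective, so the two finite types have equal size
    and [h] is bijective. *)
Lemma rotate_cycles (V W I : finType) (c : I -> seq V) (c' : I -> seq W)
    (s : V -> V) (s' : W -> W) (al : I -> int) :
  cycle_partition c s -> cycle_partition c' s' ->
  (forall t, size (c t) = size (c' t)) ->
  exists h : V -> W, [/\ bijective h, forall v, h (s v) = s' (h v) &
    forall t v, v \in c t -> h v \in c' t /\
  ((index (h v) (c' t))%:Z = ((index v (c t))%:Z + al t)%R %[mod (size (c
    t))%:Z])%Z].
Proof.
move=> cP cP' size_eq; have [h hP] := rotate_cycles_exists al cP cP' size_eq.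
have [h' /(rotate_cycles_inj cP' cP) h'I] :=
  rotate_cycles_exists al cP' cP (fun t => esym (size_eq t)).
exists h; split=> //; last exact: (rotate_cycles_commute cP cP' size_eq hP).
exact: (inj_card_bij (rotate_cycles_inj cP cP' hP) (leq_card h' h'I)).
Qed.

(** * Moving trails *)

(** In the application [p] holds on the source cycles, so these are the possible end points of a
    trail when every vertex lies on a cycle. *)
Definition crossing (V : finType) (p : pred V) (z : V * V) : bool :=
  p z.1 && ~~ p z.2.

Lemma crossing_count0 (V : finType) (p : pred V) L v w :
  all (crossing p) L -> ~~ crossing p (v, w) -> count_mem (v, w) L = 0.
Proof. by move/allP=> cL vw; apply/count_memPn; apply: contra vw;
  apply: cL. Qed.

Section ShiftingPairs.
Variables (V : finType) (s : V -> V) (p : pred V).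
Hypotheses (sI : injective s) (ps : forall v, p (s v) = p v).

(** This is the matrix P + X, with P the permutation matrix of [s]. A list is used for the trails so
    that parallel ones are counted. *)
Definition perturbed (L : seq (V * V)) (v w : V) : nat :=
  (w == s v) + count_mem (v, w) L.

Lemma perm_perturbed L L' : perm_eq L L' -> perturbed L =2 perturbed L'.
Proof. by move=> /permP LL' v w; rewrite /perturbed LL'. Qed.

(** Take R = I + e, with e the matrix unit at (s u, x), and let S be the matrix of [L]. No trail
    leaves the sink vertex x, so row x of S is the unit row at s x and e S is the unit at (s u, s
    x). No trail enters the source vertex s u, so S e is the unit at (u, x). *)
Lemma shift_pair_ese u x L : all (crossing p) ((u, x) :: L) ->
  elementary_shift_equivalent (mxf (perturbed ((s u, s x) :: L)))
                              (mxf (perturbed ((u, x) :: L))).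
Proof.
case/andP=> /andP[/= pu pNx] cL; have cL0 := crossing_count0 cL.
have Sx w : perturbed L x w = (w == s x).
  by rewrite /perturbed cL0 ?addn0 // /crossing (negPf pNx).
have Su v : perturbed L v (s u) = (u == v).
  by rewrite /perturbed cL0 ?addn0 ?(inj_eq sI) // /crossing /= ps pu andbF.
have consE y z v w : perturbed ((y, z) :: L) v w =
    perturbed L v w + (v == y) * (w == z).
  by rewrite /perturbed /= xpair_eqE mulnb addnCA addnC [y == v]eq_sym [z ==
    w]eq_sym.
apply: (mxf_ese (R := fun v w => (w == v) + (w == x) * (v == s u))
                (S := perturbed L)) => v w.
  rewrite (eq_bigr _ (fun y _ => mulnDl _ _ _)) big_split /= sum_eq1.
  under [X in _ + X]eq_bigr => y _ do rewrite -mulnA.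
  by rewrite (sum_eq1 (fun y => (v == s u) * perturbed L y w)) Sx consE.
rewrite (eq_bigr _ (fun y _ => mulnDr _ _ _)) big_split /=.
under eq_bigr => y _ do rewrite mulnC eq_sym.
rewrite sum_eq1.
under eq_bigr => y _ do rewrite mulnA mulnC.
by rewrite (sum_eq1 (fun y => perturbed L v y * (w == x))) Su consE [u ==
  v]eq_sym.
Qed.

Lemma shift_pair_sse k u x L : all (crossing p) ((u, x) :: L) ->
  strong_shift_equivalent (mxf (perturbed ((u, x) :: L)))
                          (mxf (perturbed ((iter k s u, iter k s x) :: L))).
Proof.
move=> cL; elim: k => [|k IH]; first exact: sse_refl.
apply: sse_step IH _; apply/ese_sym/shift_pair_ese.
by move: cL; rewrite /= /crossing /=; elim: k => //= k; rewrite !ps.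
Qed.

Let shift (z : V * V) := (s z.1, s z.2).

Let shift_inj : injective shift.
Proof. by move=> [a b] [a' b'] [/sI -> /sI ->]. Qed.

Lemma iter_shift k z : iter k shift z = (iter k s z.1, iter k s z.2).
Proof. by elim: k => [|k /= ->] //; case: z. Qed.

(** By induction on [L1]: its first trail is moved within its orbit onto a member of [L2], and the
    matched trail joins [L], which collects the trails already in place. *)
Lemma match_pairs_sse (L1 L2 L : seq (V * V)) :
  all (crossing p) L1 -> all (crossing p) L2 -> all (crossing p) L ->
  (forall z, crossing p z ->
    count (fconnect shift z) L1 = count (fconnect shift z) L2) ->
  strong_shift_equivalent (mxf (perturbed (L1 ++ L))) (mxf (perturbed (L2 ++
    L))).
Proof.
elim: L1 L2 L => [|z L1 IH] L2 L c1 c2 cL cnt.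
  case: L2 c2 cnt => [|z L2] c2 cnt; first exact: sse_refl.
  have /andP[cz _] := c2; have := cnt z cz.
  by rewrite /= connect0.
have /= /andP[cz c1'] := c1.
have /hasP[z' z'2 zz'] : has (fconnect shift z) L2.
  by rewrite has_count -cnt //= connect0.
have p2 := perm_to_rem z'2.
have cz' := allP c2 _ z'2.
have c2' : all (crossing p) (rem z' L2).
  by apply/allP => y /mem_rem /(allP c2).
have step : strong_shift_equivalent (mxf (perturbed ((z :: L1) ++ L)))
                                    (mxf (perturbed ((z' :: L1) ++ L))).
  move: zz' => /iter_findex <-; rewrite iter_shift.
  case: z c1 {cnt cz z'2 p2 cz'} => u x c1; apply: shift_pair_sse.
  by rewrite -cat_cons all_cat c1.
apply: sse_trans step _.
have catC3 (M : seq (V * V)) : perm_eq ((z' :: M) ++ L) (M ++ (z' :: L)).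
  by rewrite -cat1s -catA perm_catCA.
rewrite (eq_mxf (perm_perturbed (catC3 _))).
have -> : mxf (perturbed (L2 ++ L)) = mxf (perturbed (rem z' L2 ++ z' :: L)).
  apply/eq_mxf/perm_perturbed; apply: perm_trans (catC3 _).
  by rewrite perm_cat2r.
apply: IH => //=; first by rewrite cz'.
(* The trails [z] and [z'] lie in one orbit, so both counts drop by the same amount for every
   orbit. *)
move=> y cy; have := cnt y cy; rewrite (permP p2) /=.
rewrite !(fconnect_sym shift_inj y) (same_connect (fconnect_sym shift_inj) zz').
exact: addnI.
Qed.

End ShiftingPairs.

(** * Intertwiners *)

Lemma sum_perturbed (V : finType) (s : V -> V) L v (f : V -> nat) :
  \sum_x perturbed s L v x * f x = f (s v) + \sum_x count_mem (v, x) L * f x.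
Proof.
rewrite -(sum_eq1 f (s v)) -big_split /=; apply: eq_bigr => x _.
by rewrite -mulnDl.
Qed.

Lemma sum_perturbed_sink (V : finType) (s : V ->
  V) (p : pred V) L v (f : V -> nat) :
  all (crossing p) L -> ~~ p v -> \sum_x perturbed s L v x * f x = f (s v).
Proof.
move=> cL pv; rewrite sum_perturbed big1 ?addn0 // => x _.
by rewrite (crossing_count0 cL) // /crossing (negPf pv).
Qed.

Section NoFlow.
Variables (V W : finType) (s : V -> V) (t : W -> W) (p : pred V) (q : pred W).
Variables (L : seq (V * V)) (M : seq (W * W)) (R : V -> W -> nat).
Hypotheses (sI : injective s) (ps : forall v, p (s v) = p v).
Hypothesis cL : all (crossing p) L.
Hypothesis exitM : forall u, q u -> exists k w, (iter k t u, w) \in M.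
Hypothesis intertwine : forall v w,
  \sum_x perturbed s L v x * R x w = \sum_u R v u * perturbed t M u w.

Let R_sink v w : ~~ p v -> R (s v) w = \sum_u R v u * perturbed t M u w.
Proof. by move=> pv; rewrite -intertwine (sum_perturbed_sink _ _ cL). Qed.

Let R_step v u : ~~ p v -> R v u <= R (s v) (t u).
Proof.
move=> pv; rewrite R_sink // (bigD1 u) //= /perturbed eqxx mulnDr muln1.
by rewrite -addnA leq_addr.
Qed.

(* Summed over all sink vertices, both sides of the intertwining relation have
   the same total, which forces [R] to avoid the vertices with an exit. *)
Let R_exit v u w : ~~ p v -> (u, w) \in M -> R v u = 0.
Proof.
move=> pv uw.
have row_sum v' : \sum_w R v' w + \sum_u R v' u * \sum_w count_mem (u, w) M =
    \sum_w \sum_u R v' u * perturbed t M u w.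
  rewrite exchange_big /= -big_split; apply: eq_bigr => u' _ /=.
  rewrite -big_distrr /= /perturbed big_split /= mulnDr; congr (_ + _).
  by under eq_bigr do rewrite -[nat_of_bool _]muln1;
    rewrite (sum_eq1 (fun=> 1)) muln1.
have : \sum_(v | ~~ p v) \sum_u R v u * \sum_w count_mem (u, w) M = 0.
  apply/eqP; rewrite -(eqn_add2l (\sum_(v | ~~ p v) \sum_w R v w)) addn0.
  rewrite -big_split [X in _ == X](reindex_inj sI) /=.
  rewrite [X in _ == X](eq_bigl (fun v => ~~ p v)) => [|x]; last by rewrite ps.
  apply/eqP/eq_bigr => x px; rewrite row_sum.
  by apply: eq_bigr => y _; rewrite R_sink.
move/eqP; rewrite sum_nat_eq0 => /forallP/(_ v); rewrite pv /= sum_nat_eq0.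
move/forallP/(_ u); rewrite muln_eq0 sum_nat_eq0 => /orP[/eqP //|/forallP/(_
  w)].
by rewrite /= => /eqP/count_memPn; rewrite uw.
Qed.

(** By [R_step] the entry at (v, u) does not decrease when both indices advance along their cycles,
    and it is 0 once the second one reaches a vertex with an exit. *)
Lemma no_flow v u : ~~ p v -> q u -> R v u = 0.
Proof.
move=> pv /exitM[k [w uw]]; apply/eqP; rewrite -leqn0.
have pk j : p (iter j s v) = p v by elim: j => //= j; rewrite ps.
have <- : R (iter k s v) (iter k t u) = 0 by apply: R_exit uw; rewrite pk.
elim: (k) => //= j IH; apply: leq_trans IH _.
by apply: R_step; rewrite pk.
Qed.

End NoFlow.

(** * Nonnegative factors of a permutation matrix *)

Section PermutationRows.
Variables (V W : finType) (R : V -> W -> nat) (S : W -> V -> nat).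
Variables (a : pred V) (b : pred W) (r : V -> V) (r' : W -> W).
Hypotheses (Rab : forall v w, a v -> 0 < R v w -> b w).
Hypotheses (RS : forall v x, a v -> \sum_w R v w * S w x = (x == r v)).
Hypotheses (SR : forall w y, b w -> \sum_v S w v * R v y = (y == r' w)).

(** If R v w is positive, row w of S is nonzero and can only be supported at [r v]. Two positive
    entries in row v of R would thus make the entry of R S at (v, r v) at least 2, and a single
    entry exceeding 1 would do the same. *)
Lemma unit_row v : a v -> exists2 w, b w & forall w', R v w' = (w' == w).
Proof.
move=> av; have term w x : R v w * S w x <= (x == r v).
  by rewrite -RS // (bigD1 w) //= leq_addr.
have S_gt0 w : b w -> exists x, 0 < S w x.
  move=> bw; have : 0 < \sum_v S w v * R v (r' w) by rewrite SR ?eqxx.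
  rewrite lt0n sum_nat_eq0 negb_forall => /existsP[x]; rewrite /= muln_eq0.
  by rewrite negb_or -!lt0n => /andP[Sx _]; exists x.
have S_r w : 0 < R v w -> 0 < S w (r v).
  move=> Rw; have [x Sx] := S_gt0 w (Rab av Rw); case: (x =P r v) => [<- //|xr].
  by have := term w x; rewrite (introF eqP xr) leqn0 muln_eq0 (gtn_eqF Rw)
    (gtn_eqF Sx).
have : 0 < \sum_w R v w * S w (r v) by rewrite RS ?eqxx.
rewrite lt0n sum_nat_eq0 negb_forall => /existsP[w]; rewrite /= muln_eq0.
rewrite negb_or -!lt0n => /andP[Rw Sw]; exists w => [|w']; first exact: Rab Rw.
have [->|ww'] := eqVneq w' w.
  apply/eqP; rewrite eqn_leq Rw andbT.
  by apply: leq_trans (leq_pmulr _ Sw) _; have := term w (r v); rewrite eqxx.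
case: (posnP (R v w')) => // Rw'.
have := RS (r v) av; rewrite eqxx (bigD1 w) //= (bigD1 w') //= addnA.
have := muln_gt0 (R v w) (S w (r v)); rewrite Rw Sw.
have := muln_gt0 (R v w') (S w' (r v)); rewrite Rw' (S_r _ Rw').
by case: (R v w' * _) => // ?; case: (R v w * _) => // ?; rewrite !addnS.
Qed.

(** Row w of S has a positive entry at some x, and positivity of R v w and R v' w forces both [r v]
    and [r v'] to equal x. *)
Lemma unit_row_inj v v' w :
  injective r -> a v -> a v' -> 0 < R v w -> 0 < R v' w -> v = v'.
Proof.
move=> rI av av' Rw Rw'; apply: rI.
have bw := Rab av Rw.
have : 0 < \sum_v S w v * R v (r' w) by rewrite SR ?eqxx.
rewrite lt0n sum_nat_eq0 negb_forall => /existsP[x]; rewrite /= muln_eq0.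
rewrite negb_or -!lt0n => /andP[Sx _].
have eqr u : a u -> 0 < R u w -> r u = x.
  move=> au Ru; have := RS x au; case: (x =P r u) => // _.
  move/eqP; rewrite sum_nat_eq0 => /forallP/(_ w); rewrite /= muln_eq0.
  by rewrite (gtn_eqF Ru) (gtn_eqF Sx).
by rewrite !eqr.
Qed.

Lemma unit_row_surj w : (forall w v, b w -> 0 < S w v -> a v) ->
  (exists2 w0, b w0 & r' w0 = w) -> exists2 v, a v & 0 < R v w.
Proof.
move=> Sba [w0 bw0 <-].
have : 0 < \sum_v S w0 v * R v (r' w0) by rewrite SR ?eqxx.
rewrite lt0n sum_nat_eq0 negb_forall => /existsP[x]; rewrite /= muln_eq0.
by rewrite negb_or -!lt0n => /andP[Sx Rx]; exists x => //; apply: Sba Sx.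
Qed.

End PermutationRows.

(** P + X is block triangular, so outside the source-to-sink block its powers are those of P. *)
Lemma perturbed_exp (V : finType) (s : V -> V) (p : pred V) L l v x :
  (forall v, p (s v) = p v) -> all (crossing p) L -> ~~ p v || p x ->
  (mxf (perturbed s L) ^+ l)%R (enum_rank v) (enum_rank x) = (x == iter l s v).
Proof.
move=> ps cL; elim: l v => [|l IH] v vx.
  by rewrite expr0 mxE (inj_eq enum_rank_inj) eq_sym; case: eqP.
have pk k y : p (iter k s y) = p y by elim: k => //= k; rewrite ps.
rewrite exprS -mulmxE mulmx_enum.
under eq_bigr => y _ do rewrite mxfE.
rewrite sum_perturbed IH ?ps // -iterSr big1 ?addn0 // => y _.
case: (boolP (crossing p (v, y))) => [/andP[/= pv py]|cvy].
  rewrite pv /= in vx; rewrite IH ?py // (_ : (x == _) = false) ?muln0 //.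
  by apply: contraNF py => /eqP xE; rewrite -(pk l) -xE.
by rewrite (crossing_count0 cL cvy).
Qed.

(** The bijection [h] is read off the unit rows of R at sink vertices and the unit columns of R at
    source vertices. [T] is the remaining block of R with columns transported by [h], and the last
    clause is the intertwining relation on that block. *)
Lemma shift_equivalent_perturbed (V W : finType) (s : V -> V) (t : W -> W)
    (p : pred V) (q : pred W) (L : seq (V * V)) (M : seq (W * W)) :
  injective s -> injective t ->
  (forall v, p (s v) = p v) -> (forall w, q (t w) = q w) ->
  all (crossing p) L -> all (crossing q) M ->
  (forall v, p v -> exists k x, (iter k s v, x) \in L) ->
  (forall w, q w -> exists k y, (iter k t w, y) \in M) ->
  shift_equivalent (mxf (perturbed s L)) (mxf (perturbed t M)) ->
  exists (h : V -> W) (T : V -> V -> nat),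
    [/\ bijective h, forall v, q (h v) = p v, forall v, h (s v) = t (h v) &
        forall v x, p v -> ~~ p x ->
          T (s v) (s x) + count_mem (v, s x) L =
          count_mem (h v, h (s x)) M + T v x].
Proof.
move=> sI tI ps qt cL cM exL exM [R' [S' [l [AR SA RS SR]]]].
pose R (v : V) (w : W) : nat := R' (enum_rank v) (enum_rank w).
pose S (w : W) (v : V) : nat := S' (enum_rank w) (enum_rank v).
have {}AR v w : \sum_x perturbed s L v x * R x w = \sum_u R v u * perturbed t M
  u w.
  have /matrixP/(_ (enum_rank v) (enum_rank w)) := AR.
  rewrite !mulmx_enum; under eq_bigr => y _ do rewrite mxfE.
  by under [in RHS]eq_bigr => y _ do rewrite mxfE.
have {}SA w v : \sum_u perturbed t M w u * S u v = \sum_x S w x * perturbed s L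
  x v.
  have /matrixP/(_ (enum_rank w) (enum_rank v)) := esym SA.
  rewrite !mulmx_enum; under eq_bigr => y _ do rewrite mxfE.
  by under [in RHS]eq_bigr => y _ do rewrite mxfE.
have {}RS v x : ~~ p v || p x -> \sum_w R v w * S w x = (x == iter l s v).
  by move=> vx; rewrite -(perturbed_exp l ps cL vx) -RS mulmx_enum.
have {}SR w y : ~~ q w || q y -> \sum_v S w v * R v y = (y == iter l t w).
  by move=> wy; rewrite -(perturbed_exp l qt cM wy) -SR mulmx_enum.
have R0 := no_flow sI ps cL exM AR.
have S0 := no_flow tI qt cM exL SA.
have [s' sK s'K] := injF_bij sI; have [t' tK t'K] := injF_bij tI.
have iterK (U : finType) (f g : U -> U) k : cancel f g ->
  cancel (iter k f) (iter k g).
  by move=> fK; elim: k => [|k IH] y //; rewrite iterSr iterS fK IH.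
have qt' w : q (t' w) = q w by rewrite -{2}(t'K w) qt.
have iter_stable (U : finType) (f : U -> U) (o : pred U) k v :
  (forall v, o (f v) = o v) -> o (iter k f v) = o v.
  by move=> of_; elim: k => //= k; rewrite of_.
have iterI (U : finType) (f : U -> U) k : injective f -> injective (iter k f).
  by move=> fI; elim: k => //= k IH y z /fI /IH.
have Rab v w : ~~ p v -> 0 < R v w -> ~~ q w.
  by move=> pv; apply: contraL => qw; rewrite R0.
have Sba w v : ~~ q w -> 0 < S w v -> ~~ p v.
  by move=> qw; apply: contraL => pv; rewrite S0.
have RSsink v x : ~~ p v -> \sum_w R v w * S w x = (x == iter l s v).
  by move=> pv; rewrite RS ?pv.
have SRsink w y : ~~ q w -> \sum_v S w v * R v y = (y == iter l t w).
  by move=> qw; rewrite SR ?qw.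
have Rba w v : q w -> 0 < R v w -> p v.
  by move=> qw; apply: contraTT => pv; rewrite R0.
have Sab v w : p v -> 0 < S w v -> q w.
  by move=> pv; apply: contraTT => qw; rewrite S0.
(* At sources the factorisation is transposed: the products become powers of the inverse
   permutations, and the lemmas on rows then describe the columns of R. *)
have SRsource w y : q w -> \sum_v R v w * S y v = (y == iter l t' w).
  move=> qw; under eq_bigr do rewrite mulnC.
  by rewrite SR ?qw ?orbT // -(can2_eq (iterK _ _ _ l tK) (iterK _ _ _ l t'K))
    eq_sym.
have RSsource v x : p v -> \sum_w S w v * R x w = (x == iter l s' v).
  move=> pv; under eq_bigr do rewrite mulnC.
  by rewrite RS ?pv ?orbT // -(can2_eq (iterK _ _ _ l sK) (iterK _ _ _ l s'K))
    eq_sym.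
pose Rt w v := R v w; pose St v w := S w v.
have source_col := @unit_row _ _ Rt St q p _ _ Rba SRsource RSsource.
have source_inj := @unit_row_inj _ _ Rt St q p _ _ Rba SRsource RSsource.
have source_surj := @unit_row_surj _ _ Rt St q p _ RSsource.
have sink_row := @unit_row _ _ R S _ _ _ _ Rab RSsink SRsink.
have sink_inj := @unit_row_inj _ _ R S _ _ _ _ Rab RSsink SRsink.
have sink_surj := @unit_row_surj _ _ R S _ _ _ SRsink.
have [v|h hP] := @fin_all_exists V (fun=> W) (fun v w => q w = p v /\
    if p v then forall v', R v' w = (v' == v) else forall w',
      R v w' = (w' == w)).
  case: (boolP (p v)) => pv; last first.
    have [w /negPf qw Rw] := sink_row v pv.
    by exists w; rewrite qw.
  have [|w qw Rvw] := source_surj v Sab.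
    by exists (iter l s v); rewrite ?iter_stable //; apply: iterK.
  exists w; rewrite qw; split=> // v'; have [v0 _ Rv0] := source_col w qw.
  by move: Rvw; rewrite Rv0 -[R v' w]/(Rt w v') Rv0; case: (v =P v0) => // ->.
have hI : injective h.
  move=> v v' E; have [qv] := hP v; have [qv'] := hP v'.
  rewrite E qv' in qv; rewrite -qv.
  case: (boolP (p v')) => pv' Rv' Rv.
    by apply/eqP; rewrite -[_ == _]lt0b -Rv' -E Rv eqxx.
  by apply: (sink_inj _ _ (h v')); rewrite ?Rv ?Rv' ?E ?eqxx //;
    [exact: iterI | rewrite -qv].
have hsurj w : exists v, h v = w.
  have [qw|qw] := boolP (q w).
    have [v pv Rwv] := source_col w qw; exists v.
    have [qhv] := hP v; rewrite pv => Rhv.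
    apply: (source_inj _ _ v) => //; first exact: iterI (can_inj t'K).
    - by rewrite qhv.
    - by rewrite /Rt Rhv eqxx.
    - by rewrite Rwv eqxx.
  have [|v pv Rvw] := sink_surj (fun v => ~~ p v) w Sba.
    by exists (iter l t' w); rewrite ?iter_stable //; apply: iterK.
  exists v; have [_] := hP v; rewrite (negPf pv) => Rv.
  by apply/eqP; rewrite eq_sym -[_ == _]lt0b -Rv.
have hB : bijective h.
  have [h' h'K] := fin_all_exists hsurj.
  by exists h' => // v; apply: hI; rewrite h'K.
exists h, (fun v x => R v (h x)).
have Rsink v w : ~~ p v -> R v w = (w == h v).
  by move=> pv; have [_] := hP v; rewrite (negPf pv).
have Rsource v v' : p v' -> R v (h v') = (v == v').
  by move=> pv; have [_] := hP v'; rewrite pv.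
have hq v : q (h v) = p v by case: (hP v).
have AR_sum v w : R (s v) w + \sum_x count_mem (v, x) L * R x w =
    R v (t' w) + \sum_u R v u * count_mem (u, w) M.
  rewrite -(sum_perturbed _ _ _ (R^~ w)) AR -(sum_eq1 (R v) (t' w)) -big_split.
  apply: eq_bigr => u _; rewrite /perturbed mulnDr; congr (_ + _).
  by rewrite mulnC eq_sym (can2_eq tK t'K).
(* At a source vertex, compare the entries at (v, h (s v)), where both trail sums vanish. At a sink
   vertex, compare those at (v, t (h v)), where no trail starts at v or at h v. *)
have hst v : h (s v) = t (h v).
  have [pv|pv] := boolP (p v).
    have [v0 v0E] : exists v0, h v0 = t' (h (s v)) by apply: hsurj.
    have pv0 : p v0 by rewrite -hq v0E qt' hq ps.
    have := AR_sum v (h (s v)); rewrite Rsource ?ps // eqxx -v0E Rsource //.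
    rewrite !big1 => [|u _|x _]; first by case: (v =P v0) => // {2}-> _;
      rewrite v0E t'K.
      by rewrite (crossing_count0 cM) ?muln0 // /crossing /= hq ps pv andbF.
    have [px|px] := boolP (p x); last by rewrite R0 ?hq ?ps ?muln0.
    by rewrite (crossing_count0 cL) // /crossing /= px andbF.
  have := AR v (t (h v)); rewrite (sum_perturbed_sink _ _ cL) // Rsink ?ps //.
  rewrite (eq_bigr (fun u => (u == h v) * perturbed t M u (t (h v)))) => [|u _].
    rewrite sum_eq1 /perturbed eqxx (crossing_count0 cM) ?addn0.
      by case: eqP.
    by rewrite /crossing /= hq (negPf pv).
  by rewrite Rsink.
split=> // v x pv px.
(* Trails end at sinks and start at sources. There the relevant rows and columns of R are those of
   [h], so each trail sum collapses to one term. *)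
have := AR_sum v (h (s x)); rewrite {3}hst tK => E.
rewrite [RHS]addnC; rewrite (eq_bigr (fun y => (y == s x) * count_mem (v,
  y) L)) in E.
  rewrite sum_eq1 in E; rewrite E; congr (_ + _).
  rewrite -(sum_eq1 (fun u => count_mem (u, h (s x)) M) (h v)).
  apply: eq_bigr => u _; have [v0 <-] := hsurj u.
  have [pv0|pv0] := boolP (p v0); first by rewrite Rsource // (inj_eq hI)
    eq_sym.
  by rewrite (crossing_count0 cM) ?muln0 // /crossing /= hq (negPf pv0).
move=> y _; have [py|py] := boolP (p y).
  by rewrite (crossing_count0 cL) ?muln0 // /crossing /= py andbF.
by rewrite Rsink // (inj_eq hI) mulnC eq_sym.
Qed.

(** * Cycle structure of a graph in normal form *)

Lemma index_cycle_vertices (E : graph) (c : seq (edge E)) e :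
  uniq (cycle_vertices c) -> e \in c ->
  index (src e) (cycle_vertices c) = index e c.
Proof.
move=> cU ec; have ei := ec; rewrite -index_mem in ei.
rewrite -{1}(nth_index e ec) -(nth_map _ (src e)) //.
by rewrite index_uniq // size_map.
Qed.

Lemma is_cycle_rng (E : graph) (c : seq (edge E)) e :
  is_cycle c -> e \in c -> rng e = next (cycle_vertices c) (src e).
Proof.
case/and3P=> _ cC cU ec; have := next_cycle cC ec;
  rewrite /consecutive => /eqP ->.
rewrite !next_nth ec (map_f (@src E)) // index_cycle_vertices //.
case: c {cC cU} ec => // f c; rewrite -index_mem; move: (index e _) => i.
rewrite ltnS leq_eqVlt /= => /orP[/eqP ->|lt]; last by rewrite (nth_map f).
by rewrite !nth_default // size_map.
Qed.

(** Follow [e] by the arc of [c] from the range of [e] back to its source; if these coincide, [e] is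
    a loop and the arc is empty. *)
Lemma is_cycle_shortcut (E : graph) (c : seq (edge E)) e : is_cycle c ->
  src e \in cycle_vertices c -> rng e \in cycle_vertices c ->
  exists c', is_cycle (e :: c').
Proof.
move=> cC /mapP[g gc eg] /mapP[f fc ef]; case/rot_to: fc => k c1 c1E.
have : is_cycle (f :: c1).
  case/and3P: cC => _ cC cU; rewrite -c1E /is_cycle rot_cycle map_rot rot_uniq
    cC cU !andbT.
  by rewrite -size_eq0 size_rot; case: (c) gc.
have : g \in f :: c1 by rewrite -c1E mem_rot.
rewrite inE => /predU1P[gf|/splitPr[p1 p2]] /and3P[_ c1C c1U].
  by exists [::]; rewrite /is_cycle /= /consecutive ef -gf -eg eqxx.
exists (f :: p1); move: c1C c1U; rewrite /= rcons_cat cat_path /= map_cat.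
case/and3P=> fp1 lg _ /andP[]; rewrite mem_cat negb_or /= => /andP[fNp1].
rewrite inE negb_or => /andP[fNg _]; rewrite cat_uniq /= => /and3P[p1U gN _].
rewrite /is_cycle /= rcons_path fp1 {1}/consecutive ef eqxx {1}/consecutive eg.
rewrite (eqP lg) eqxx fNp1 p1U inE negb_or eq_sym fNg /= !andbT.
by case/norP: gN.
Qed.

Section CycleStructure.
Variables (E : graph) (m n : nat) (d : cycle_numbering E m n).
Hypothesis dP : source_sink_structure d.

Definition cyc (t : 'I_m + 'I_n) : seq (edge E) :=
  match t with inl i => source_cycle d i | inr j => sink_cycle d j end.

Definition cycv t : seq (vertex E) := cycle_vertices (cyc t).

Lemma cyc_is_cycle t : is_cycle (cyc t).
Proof. by case: t => ?; [apply: source_cycleP | apply: sink_cycleP]. Qed.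

Lemma on_sourceP v : reflect (exists i, v \in cycv (inl i)) (on_source_cycle d
  v).
Proof. exact: existsP. Qed.

Lemma on_sinkP v : reflect (exists j, v \in cycv (inr j)) (on_sink_cycle d v).
Proof. exact: existsP. Qed.

Lemma source_not_sink v : on_source_cycle d v -> ~~ on_sink_cycle d v.
Proof. by move=> vs; have := source_sink_disjoint dP v; rewrite vs. Qed.

Lemma cycv_disjoint t t' v : v \in cycv t -> v \in cycv t' -> t = t'.
Proof.
have NS i j : v \in cycv (inl i) -> v \in cycv (inr j) -> False.
  move=> vi vj; have /source_not_sink/negP[] : on_source_cycle d v by
    apply/on_sourceP; exists i.
  by apply/on_sinkP; exists j.
case: t t' => [i|j] [i'|j'] vt vt'.
- by rewrite (source_source_disjoint dP vt vt').
- by case: (NS i j').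
- by case: (NS i' j).
- by rewrite (sink_sink_disjoint dP vt vt').
Qed.

Lemma is_cycle_cyc c : is_cycle c -> exists t k, c = rot k (cyc t).
Proof.
by case/(all_cycles dP) => [[i [k ->]]|[j [k ->]]];
  [exists (inl i), k | exists (inr j), k].
Qed.

(** A chord would give a cycle that meets [cyc t]. By disjointness that cycle is a rotation of
    [cyc t], which therefore contains the edge. *)
Lemma edge_in_cyc t e : src e \in cycv t -> rng e \in cycv t -> e \in cyc t.
Proof.
move=> st rt; have [c' eC] := is_cycle_shortcut (cyc_is_cycle t) st rt.
have [t' [k cE]] := is_cycle_cyc eC.
have et' : e \in cyc t' by rewrite -(mem_rot k) -cE inE eqxx.
by rewrite (cycv_disjoint st (map_f _ et')).
Qed.

Definition covers : Prop := forall v, on_source_cycle d v || on_sink_cycle d v.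

(** A list rather than a set, so that parallel trails keep their multiplicity. *)
Definition trail_pairs : seq (vertex E * vertex E) :=
  [seq (src e, rng e) | e <- enum (edge E) & is_trail d [:: e]].

Lemma is_trail1 e :
  is_trail d [:: e] = on_source_cycle d (src e) && on_sink_cycle d (rng e).
Proof. by rewrite /= andbT. Qed.

Lemma trail_pairs_crossing : all (crossing (on_source_cycle d)) trail_pairs.
Proof.
rewrite all_map; apply/allP => e; rewrite mem_filter is_trail1 => /andP[/andP[es
  er] _].
by rewrite /= /crossing /= es /=; apply: contraL er; apply: source_not_sink.
Qed.

Hypothesis cov : covers.

Lemma cycv_cover v : exists t, v \in cycv t.
Proof.
by case/orP: (cov v) => [/on_sourceP[i]|/on_sinkP[j]];
  [exists (inl i) | exists (inr j)].
Qed.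

Lemma cycv_partition : exists s, cycle_partition cycv s.
Proof.
have [v|s sP] := @fin_all_exists _ (fun=> vertex E)
    (fun v w => forall t, v \in cycv t -> w = next (cycv t) v).
  have [t vt] := cycv_cover v; exists (next (cycv t) v) => t' /(cycv_disjoint
    vt).
  by move=> ->.
exists s; split=> [|t t' v|t|t|t v].
- exact: cycv_cover.
- exact: cycv_disjoint.
- by case/and3P: (cyc_is_cycle t).
- by rewrite size_map lt0n size_eq0; case/and3P: (cyc_is_cycle t).
- exact: sP.
Qed.

Lemma edge_count_perturbed s : cycle_partition cycv s ->
  @edge_count E =2 perturbed s trail_pairs.
Proof.
move=> sP v w; have [t vt] := cycv_cover v; have [e0 e0t vE] := mapP vt.
have e0r : rng e0 = s v.
  by rewrite (is_cycle_rng (cyc_is_cycle t) e0t) -vE;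
    case: sP => _ _ _ _ /(_ _ _ vt) ->.
have srcU := cyc_is_cycle t; case/and3P: srcU => _ _ srcU.
(* Exactly one edge leaving v is not a trail, the cycle edge [e0]: any other would enter a source
   cycle, leave a sink cycle or be a chord. *)
have nontrail e : src e = v -> ~~ is_trail d [:: e] = (e == e0).
  move=> ev; apply/idP/eqP => [|->]; rewrite is_trail1.
    move=> nt; have rt : rng e \in cycv t.
      case: (t) vt => [i|j] vi; last by apply: (sink_no_exit dP); rewrite ev.
      have vs : on_source_cycle d v by apply/on_sourceP; exists i.
      move: nt; rewrite ev vs /= => nt; have [[i'|j] ri] := cycv_cover (rng e).
        have : src e \in cycv (inl i') by apply: (source_no_entry dP).
        by rewrite ev => /(cycv_disjoint vi) ->.
      by case/negP: nt; apply/on_sinkP; exists j.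
    have et : e \in cyc t by apply: edge_in_cyc => //; rewrite ev.
    have := index_cycle_vertices srcU et.
    rewrite ev vE (index_cycle_vertices srcU e0t) => ix.
    by rewrite -(nth_index e0 et) -ix nth_index.
  have rt : rng e0 \in cycv t by rewrite e0r (cycle_partition_mem sP).
  apply/negP=> /andP[/on_sourceP[i] si /on_sinkP[j] rj].
  have := cycv_disjoint rt rj; rewrite -vE in si.
  by rewrite (cycv_disjoint vt si).
rewrite /perturbed count_map count_filter /edge_count.
rewrite -(cardsID [set e | is_trail d [:: e]]) addnC; congr (_ + _).
  case: eqP => [->|ws].
    rewrite (_ : _ :\: _ = [set e0]) ?cards1 //; apply/setP => e; rewrite !inE.
    have [ev|ev] := eqVneq (src e) v.
      by rewrite nontrail //; case: eqP => // ->; rewrite e0r eqxx.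
    by rewrite andbF; apply/esym/eqP => ee0; rewrite ee0 -vE eqxx in ev.
  rewrite (_ : _ :\: _ = set0) ?cards0 //; apply/setP => e; rewrite !inE.
  apply/and3P => -[nt /eqP ev /eqP rw]; case: ws.
  by move: nt; rewrite nontrail // => /eqP ee0; rewrite -rw ee0.
rewrite cardE size_filter -enumT; apply: eq_count => e.
by rewrite !inE /= xpair_eqE.
Qed.

End CycleStructure.

(** * Trails and cycles in normal form *)

Section NormalForm.
Variables (E : graph) (m n : nat) (d : cycle_numbering E m n).
Hypothesis dP : source_sink_structure d.

Let off v := ~~ on_source_cycle d v && ~~ on_sink_cycle d v.

(** Cut the path after its last vertex on a source cycle. The rest avoids sink cycles, since they
    cannot be left and v lies off them. *)
Lemma path_from_source u v : connect (@adj E) u v ->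
  on_source_cycle d u -> off v ->
  exists e q, [/\ path (@consecutive E) e q, on_source_cycle d (src e),
                  rng (last e q) = v & all (fun f => off (rng f)) (e :: q)].
Proof.
move=> /connectP[p pP ->] us; elim/last_ind: p pP => [|p x IH].
  by rewrite /off /= us.
rewrite rcons_path last_rcons => /andP[/IH{}IH /existsP[f /andP[/eqP fs /eqP
  fr]]] ox.
have [ys|ys] := boolP (on_source_cycle d (last u p)).
  by exists f, [::]; rewrite /= fs fr ys ox.
have [/existsP[j yj]|yk] := boolP (on_sink_cycle d (last u p)).
  case/andP: ox => _ /negP[]; apply/existsP; exists j.
  by rewrite -fr; apply: (sink_no_exit dP); rewrite fs.
have [|e [q [eq es er eo]]] := IH; first by rewrite /off ys.
exists e, (rcons q f); rewrite rcons_path last_rcons -rcons_cons all_rcons eo fr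
  ox.
by rewrite eq es /consecutive er fs eqxx.
Qed.

Lemma path_to_sink v w : connect (@adj E) v w ->
  on_sink_cycle d w -> off v ->
  exists e q, [/\ path (@consecutive E) e q, src e = v,
                  on_sink_cycle d (rng (last e q)) &
                  all (fun f => off (rng f)) (belast e q)].
Proof.
move=> /connectP[p + ->] => + ws; elim: p v ws => [|x p IH] v /= ws.
  by rewrite /off ws andbF.
case/andP=> /existsP[f /andP[/eqP fs /eqP fr]] pP vo.
have [xk|xk] := boolP (on_sink_cycle d x).
  by exists f, [::]; rewrite /= fs fr.
have [/existsP[i xi]|xs] := boolP (on_source_cycle d x).
  case/andP: vo => /negP[]; apply/existsP; exists i.
  by rewrite -fs; apply: (source_no_entry dP); rewrite fr.
have ox : off x by rewrite /off xs.
have [e [q [eq es er eo]]] := IH x ws pP ox.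
by exists f, (e :: q); rewrite /= /consecutive eq es fr eqxx ox.
Qed.

(** A vertex off the cycles would be an inner vertex of a trail, which would then have at least two
    edges. *)
Lemma single_edge_trails_cover :
  (forall p, is_trail d p -> size p = 1) -> covers d.
Proof.
move=> trail1 v; apply: contraT; rewrite negb_or => /andP[vs vk].
have [u [w [us wk uv vw]]] := off_cycle_vertex dP vs vk.
have ov : off v by rewrite /off vs.
have [e [q [eq es er eo]]] := path_from_source uv us ov.
have [e' [q' [eq' es' er' eo']]] := path_to_sink vw wk ov.
have /trail1 : is_trail d (e :: q ++ e' :: q').
  rewrite /is_trail cat_path eq last_cat /= {1}/consecutive er es' eqxx eq' es
    er'.
  rewrite belast_cat all_cat /= er -/(off v) ov eo' !andbT.
  by apply/allP => f /mem_belast; apply: (allP eo).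
by case; rewrite size_cat addnS.
Qed.

Hypothesis cov : covers d.

(** Without such a trail the cycle would be closed under edges in both directions, and by
    connectedness it would contain the vertices of a sink cycle. *)
Lemma source_cycle_exit i : connected E ->
  exists2 e, src e \in cycv d (inl i) & is_trail d [:: e].
Proof.
move=> conn.
have [/existsP[e /andP[ei et]]|] :=
  boolP [exists e : edge E, (src e \in cycv d (inl i)) && is_trail d [:: e]].
  by exists e.
rewrite negb_exists => /forallP noexit.
have closed_i x y : adj x y -> (x \in cycv d (inl i)) = (y \in cycv d (inl i)).
  case/existsP=> e /andP[/eqP <- /eqP <-]; apply/idP/idP => [si|]; last first.
    exact: (source_no_entry dP).
  have := noexit e; rewrite si is_trail1 /=.
  have -> /= : on_source_cycle d (src e) by apply/on_sourceP; exists i.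
  move=> nk; have := cov (rng e); rewrite (negPf nk) orbF => /on_sourceP[i'
    ri'].
  have si' : src e \in cycv d (inl i') by apply: (source_no_entry dP).
  by rewrite (cycv_disjoint dP si si').
have [x xi] : exists x, x \in cycv d (inl i).
  have := source_cycleP dP i; case E0: (source_cycle d i) => [|f c] // _.
  by exists (src f); rewrite /cycv /= E0 mem_head.
have j0 : 'I_n := Ordinal (sink_count_gt0 dP).
have [y yj] : exists y, y \in cycv d (inr j0).
  have := sink_cycleP dP j0; case E0: (sink_cycle d j0) => [|f c] // _.
  by exists (src f); rewrite /cycv /= E0 mem_head.
have yi : y \in cycv d (inl i).
  rewrite -(closed_connect (e := fun x y => adj x y || adj y x) _ (conn x y))
    //.
  by move=> a b /orP[/closed_i|/closed_i/esym].
by have := cycv_disjoint dP yj yi.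
Qed.

End NormalForm.

Lemma covers_transfer (E : graph) m n m' n' (d : cycle_numbering E m n)
    (d' : cycle_numbering E m' n') :
  source_sink_structure d -> source_sink_structure d' -> covers d -> covers d'.
Proof.
move=> dP dP' cov v; have [t vt] := cycv_cover cov v.
have [[i|j] [k tE]] := is_cycle_cyc dP' (cyc_is_cycle dP t).
  apply/orP; left; apply/on_sourceP; exists i.
  by move: vt; rewrite /cycv tE /cycle_vertices map_rot mem_rot.
apply/orP; right; apply/on_sinkP; exists j.
by move: vt; rewrite /cycv tE /cycle_vertices map_rot mem_rot.
Qed.

(** * Counting trails by index difference *)

Lemma dvdz_lincomb (k l d x y z : int) :
  (d %| x)%Z -> (d %| y)%Z -> z = (k * x + l * y)%R -> (d %| z)%Z.
Proof. by move=> dx dy ->; rewrite rpredD ?dvdz_mull. Qed.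

(** This is the Chinese remainder theorem for moduli that need not be coprime. With u p + v q = gcd
    and a - b = w gcd, the integer a - u p w is a solution; reducing it modulo p q makes it
    natural. *)
Lemma nat_mod_simultaneous (p q : nat) (a b : int) : 0 < p -> 0 < q ->
  ((gcdn p q)%:Z %| (a - b)%R)%Z ->
  exists k : nat, (p%:Z %| (k%:Z - a)%R)%Z /\ (q%:Z %| (k%:Z - b)%R)%Z.
Proof.
move=> p0 q0 /dvdzP[w abw]; have [u [v uv]] := Bezoutz p q.
have pq0 : ((p * q)%N%:Z != 0)%R by rewrite eqz_nat -lt0n muln_gt0 p0.
pose k0 : int := (a - u * p%:Z * w)%R.
exists `|(k0 %% (p * q)%N%:Z)%Z|%N; rewrite gez0_abs ?modz_ge0 //.
have k0E : (k0 %% (p * q)%N%:Z)%Z = (k0 - (k0 %/ (p * q)%N%:Z)%Z * (p *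
  q)%N%:Z)%R.
  by apply/eqP; rewrite eq_sym subr_eq addrC -divz_eq.
rewrite k0E PoszM; move: (k0 %/ _)%Z => r; split; apply/dvdzP.
  by exists (- u * w - r * q%:Z)%R; rewrite /k0; ring.
exists (v * w - r * p%:Z)%R; rewrite /k0.
have -> : a = (b + w * (u * p%:Z + v * q%:Z))%R.
  by rewrite uv -abw; ring.
ring.
Qed.

Definition in_class (E : graph) m n (d : cycle_numbering E m n) i j (c : int)
    (z : vertex E * vertex E) : bool :=
  [&& z.1 \in cycv d (inl i), z.2 \in cycv d (inr j) &
      ((cycle_gcd d i j)%:Z %| ((index z.2 (cycv d (inr j)))%:Z
                                - (index z.1 (cycv d (inl i)))%:Z - c)%R)%Z].

Lemma size_cycv (E : graph) m n (d : cycle_numbering E m n) t :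
  size (cycv d t) = size (cyc d t).
Proof. exact: size_map. Qed.

Lemma dvd_gcd_source (E : graph) m n (d : cycle_numbering E m n) i j x :
  ((size (cycv d (inl i)))%:Z %| x)%Z -> ((cycle_gcd d i j)%:Z %| x)%Z.
Proof. by apply: dvdz_trans; rewrite size_cycv; apply: dvdn_gcdl. Qed.

Lemma dvd_gcd_sink (E : graph) m n (d : cycle_numbering E m n) i j x :
  ((size (cycv d (inr j)))%:Z %| x)%Z -> ((cycle_gcd d i j)%:Z %| x)%Z.
Proof. by apply: dvdz_trans; rewrite size_cycv; apply: dvdn_gcdr. Qed.

Lemma trail_count_mod (E : graph) m n (d : cycle_numbering E m n) v i j c c' :
  ((cycle_gcd d i j)%:Z %| (c - c')%R)%Z ->
  trail_count d v i j c = trail_count d v i j c'.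
Proof.
rewrite -eqz_mod_dvd => /eqP cc'; rewrite /trail_count.
by apply: eq_card => e; rewrite !inE cc'.
Qed.

Section ClassOrbit.
Variables (E : graph) (m n : nat) (d : cycle_numbering E m n).
Variable (s : vertex E -> vertex E).
Hypotheses (sP : cycle_partition (cycv d) s).

Lemma index_cycv_iter t v k : v \in cycv d t ->
  ((size (cycv d t))%:Z %|
    ((index (iter k s v) (cycv d t))%:Z - (index v (cycv d t))%:Z - k%:Z)%R)%Z.
Proof.
move=> vt; rewrite -addrA -opprD -PoszD -eqz_mod_dvd !modz_nat.
by rewrite index_iter_cycle_partition.
Qed.

Lemma cycv_eq t v w : v \in cycv d t -> w \in cycv d t ->
  ((size (cycv d t))%:Z %|
    ((index v (cycv d t))%:Z - (index w (cycv d t))%:Z)%R)%Z -> v = w.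
Proof.
move=> vt wt; rewrite -eqz_mod_dvd !modz_nat eqz_nat => /eqP.
exact: index_cycle_partition_inj.
Qed.

Lemma in_class_shift i j c v x :
  in_class d i j c (s v, s x) = in_class d i j c (v, x).
Proof.
rewrite /in_class /= !(cycle_partition_mem sP).
case: (boolP (v \in _)) => //= vi; case: (boolP (x \in _)) => //= xj.
apply: eqz_mod_shift; have := index_cycv_iter 1 vi;
  have := index_cycv_iter 1 xj.
rewrite /= => /(dvd_gcd_sink i) Dx /(dvd_gcd_source j) Dv.
by apply: (dvdz_lincomb (k := 1) (l := -1) Dx Dv); ring.
Qed.

(** Shifting both vertices keeps the index difference. Conversely, congruence modulo the gcd is what
    allows one number of steps to realise the required shift on both cycles. *)
Lemma fconnect_in_class i j u x z :
  u \in cycv d (inl i) -> x \in cycv d (inr j) ->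
  fconnect (fun z => (s z.1, s z.2)) (u, x) z =
  in_class d i j ((index x (cycv d (inr j)))%:Z - (index u (cycv d (inl
    i)))%:Z)%R z.
Proof.
move=> ui xj; apply/idP/idP => [/iter_findex <-|].
  elim: (findex _ _ _) => [|k IH] /=.
    by rewrite /in_class /= ui xj subrr dvdz0.
  by rewrite in_class_shift; case: (iter k _ _) IH.
case: z => u' x' /and3P[/= ui' xj' dx].
have [p0 q0] : 0 < size (cycv d (inl i)) /\ 0 < size (cycv d (inr j)) by case:
  sP.
pose a := ((index u' (cycv d (inl i)))%:Z - (index u (cycv d (inl i)))%:Z)%R.
pose b := ((index x' (cycv d (inr j)))%:Z - (index x (cycv d (inr j)))%:Z)%R.
have [|k [ka kb]] := @nat_mod_simultaneous _ _ a b p0 q0.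
  rewrite !size_cycv; apply: (dvdz_lincomb (k := -1) (l := 0) dx dx).
  by rewrite /a /b; ring.
have -> : (u', x') = iter k (fun z => (s z.1, s z.2)) (u, x).
  rewrite iter_shift /=; congr (_, _).
    apply: (cycv_eq ui'); first by rewrite (cycle_partition_iter_mem sP).
    apply: (dvdz_lincomb (k := -1) (l := -1) ka (index_cycv_iter k ui)).
    by rewrite /a; ring.
  apply: (cycv_eq xj'); first by rewrite (cycle_partition_iter_mem sP).
  apply: (dvdz_lincomb (k := -1) (l := -1) kb (index_cycv_iter k xj)).
  by rewrite /b; ring.
exact: fconnect_iter.
Qed.

End ClassOrbit.

Section ClassCount.
Variables (E F : graph) (m n : nat).
Variables (dE : cycle_numbering E m n) (dF : cycle_numbering F m n).
Variables (h : vertex E -> vertex F) (h' : vertex F -> vertex E).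
Variables (vF : 'I_m -> vertex F) (b : 'I_n -> int).
Hypotheses (h'K : cancel h' h).
Hypothesis size_eq : forall t, size (cycv dE t) = size (cycv dF t).
Hypothesis h_mem : forall t v, (h v \in cycv dF t) = (v \in cycv dE t).
Hypothesis h_index : forall j x, x \in cycv dE (inr j) ->
  ((size (cycv dE (inr j)))%:Z %|
    ((index (h x) (cycv dF (inr j)))%:Z - (index x (cycv dE (inr j)))%:Z - b
      j)%R)%Z.
Hypothesis vFP : forall i, is_common_trail_source dF i (vF i).

(** All trails from cycle i start at [vF i], so fixing the index difference fixes the residue of the
    end index. The successor appears because [cycle_index] starts at 1, and [b j] is the rotation of
    [h] on the sink cycle. *)
Lemma count_in_class i j c :
  count (in_class dE i j c) [seq (h' z.1, h' z.2) | z <- trail_pairs dF] =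
  trail_count dF vF i j
    (c + (index (h' (vF i)) (cycv dE (inl i))).+1%:Z + b j)%R.
Proof.
rewrite /trail_pairs -map_comp count_map count_filter /trail_count cardE
  size_filter.
rewrite -enumT; apply: eq_count => e; rewrite /= inE andbT.
case: (boolP (is_trail dF [:: e])) => et; last first.
  by move: et; rewrite /= andbT => /negPf ->; rewrite andbF.
move: (et); rewrite /= andbT => ->; rewrite andbT /in_class /=.
have h'_mem t w : (h' w \in cycv dE t) = (w \in cycv dF t) by rewrite -h_mem
  h'K.
have [vi _ vuniq] := vFP i.
have -> : (h' (src e) \in cycv dE (inl i)) = (src e == vF i).
  rewrite h'_mem; apply/idP/eqP => [si|->]; last exact: vi.
  by apply: (vuniq _ [:: e] si).
case: eqP => //= ->; rewrite h'_mem; case: (boolP (rng e \in _)) => // rj.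
rewrite /= eqz_mod_dvd.
have -> : cycle_gcd dF i j = cycle_gcd dE i j.
  by rewrite /cycle_gcd; congr gcdn; rewrite -!(size_map (@src _));
    [apply: (esym (size_eq (inl i))) | apply: (esym (size_eq (inr j)))].
apply: eqz_mod_shift; have {}rj : h' (rng e) \in cycv dE (inr j) by rewrite
  h'_mem.
have := dvd_gcd_sink i (h_index rj); rewrite h'K => Dx.
apply: (dvdz_lincomb (k := -1) (l := 0) Dx Dx).
by rewrite /cycle_index -/(cycv dF (inr j)) !intS; ring.
Qed.

End ClassCount.

Lemma sum_count_mem (T : finType) (P : pred T) (L : seq T) :
  \sum_(z | P z) count_mem z L = count P L.
Proof.
elim: L => [|y L IH] /=; first by rewrite big1.
rewrite big_split /= IH; congr (_ + _); rewrite big_mkcond (bigD1 y) //= eqxx.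
rewrite big1 => [|z /negPf zy]; first by rewrite addn0; case: (P y).
by rewrite eq_sym zy; case: (P z).
Qed.

Lemma count_map_pair (V W : finType) (h : V -> W) (h' : W ->
  V) (M : seq (W * W)) v x :
  cancel h h' -> cancel h' h ->
  count_mem (v, x) [seq (h' z.1, h' z.2) | z <- M] = count_mem (h v, h x) M.
Proof.
move=> hK h'K; rewrite count_map; apply: eq_count => -[w y] /=.
by rewrite !xpair_eqE !(can2_eq h'K hK).
Qed.

(** Sum the relation over the pairs (v, x) with P (v, s x). Shifting both coordinates permutes these
    pairs, so the two sums of [T] are equal and cancel. *)
Lemma count_transfer (V W : finType) (s : V -> V) (h : V -> W) (h' : W -> V)
    (P : pred (V * V)) (L : seq (V * V)) (M : seq (W * W)) (T : V -> V -> nat) :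
  injective s -> cancel h h' -> cancel h' h ->
  (forall v x, P (s v, s x) = P (v, x)) ->
  (forall v x, P (v, s x) ->
     T (s v) (s x) + count_mem (v, s x) L = count_mem (h v,
       h (s x)) M + T v x) ->
  count P L = count P [seq (h' z.1, h' z.2) | z <- M].
Proof.
move=> sI hK h'K Ps TE.
pose f (z : V * V) := (s z.1, s z.2); pose g (z : V * V) := (z.1, s z.2).
have fI : injective f by move=> [v x] [v' x'] [/sI -> /sI ->].
have gI : injective g by move=> [v x] [v' x'] [-> /sI ->].
have : \sum_(z | P (g z)) (T (f z).1 (f z).2 + count_mem (g z) L) =
       \sum_(z | P (g z)) (count_mem (h (g z).1, h (g z).2) M + T z.1 z.2).
  by apply: eq_bigr => -[v x] Pg; exact: TE.
have -> : \sum_(z | P (g z)) (T (f z).1 (f z).2 + count_mem (g z) L) =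
          \sum_(z | P (g z)) T z.1 z.2 + count P L.
  rewrite big_split -(sum_count_mem P) [in RHS](reindex_inj fI) /=;
    congr (_ + _).
    by apply: eq_bigl => z; rewrite /g /= Ps.
  by rewrite [in RHS](reindex_inj gI).
rewrite big_split /= addnC => /addIn ->; rewrite -(sum_count_mem P).
rewrite [in RHS](reindex_inj gI) /=; apply: eq_bigr => z _.
by rewrite (count_map_pair _ _ _ hK h'K).
Qed.

Lemma on_source_cycle_shift (E : graph) m n (d : cycle_numbering E m n) s v :
  cycle_partition (cycv d) s -> on_source_cycle d (s v) = on_source_cycle d v.
Proof. by move=> sP; apply: eq_existsb => i;
  apply: (cycle_partition_mem sP (inl i)). Qed.

Lemma cycle_gcd_eq (E F : graph) m n (dE : cycle_numbering E m n)
    (dF : cycle_numbering F m n) i j :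
  (forall t, size (cycv dE t) = size (cycv dF t)) ->
  cycle_gcd dF i j = cycle_gcd dE i j.
Proof.
move=> size_eq; rewrite /cycle_gcd -!(size_map (@src _)).
by rewrite -[size _]/(size (cycv dF (inl i))) -[X in gcdn _ X]/(size (cycv dF
  (inr j))) -!size_eq.
Qed.

Lemma crossing_classes (E : graph) m n (d : cycle_numbering E m n) u x :
  covers d -> crossing (on_source_cycle d) (u, x) ->
  exists i j, u \in cycv d (inl i) /\ x \in cycv d (inr j).
Proof.
move=> cov /andP[/= /on_sourceP[i ui] xs].
by have := cov x; rewrite (negPf xs) => /on_sinkP[j xj]; exists i, j.
Qed.

Lemma count_in_class_self (E : graph) m n (d : cycle_numbering E m n) v i j c :
  (forall i, is_common_trail_source d i (v i)) ->
  count (in_class d i j c) (trail_pairs d) =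
  trail_count d v i j (c + (index (v i) (cycv d (inl i))).+1%:Z)%R.
Proof.
move=> vP; rewrite -[in RHS](addr0 (_ + _)%R).
rewrite -(@count_in_class E E m n d d id id v (fun=> 0%R)) //.
  by congr count; rewrite -[LHS]map_id; apply: eq_map => -[].
by move=> j' x _; rewrite subrr subr0 dvdz0.
Qed.

Lemma trail_counts_sse (E F : graph) m n (dE : cycle_numbering E m n)
    (dF : cycle_numbering F m n) vE vF (a : 'I_m -> int) (b : 'I_n -> int) :
  source_sink_structure dE -> source_sink_structure dF -> covers dE ->
    covers dF ->
  (forall i, is_common_trail_source dE i (vE i)) ->
  (forall i, is_common_trail_source dF i (vF i)) ->
  (forall t, size (cycv dE t) = size (cycv dF t)) ->
  (forall (c : nat) i j, trail_count dE vE i j c%:Z =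
                         trail_count dF vF i j (c%:Z + a i + b j)%R) ->
  strong_shift_equivalent (adjacency E) (adjacency F).
Proof.
move=> dEP dFP covE covF vEP vFP size_eq cnt.
have [s sP] := cycv_partition dEP covE; have [t tP] := cycv_partition dFP covF.
(* The rotation absorbs the offsets: it makes the position of [h' (vF i)] congruent to that of
   [vE i] plus [a i], and turns sink cycle j by [b j]. *)
pose al (k : 'I_m + 'I_n) : int := match k with
  | inl i => (index (vF i) (cycv dF (inl i)))%:Z
             - (index (vE i) (cycv dE (inl i)))%:Z - a i
  | inr j => b j end%R.
have [h [[h' hK h'K] hst hP]] := rotate_cycles al sP tP size_eq.
have h_mem k v : (h v \in cycv dF k) = (v \in cycv dE k).
  apply/idP/idP => [hv|/hP[] //]; have [k' vk'] := cycv_cover covE v.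
  by have [hv' _] := hP _ _ vk'; rewrite (cycv_disjoint dFP hv hv').
have on_h w : on_source_cycle dE (h' w) = on_source_cycle dF w.
  by apply: eq_existsb => i; have := h_mem (inl i) (h' w); rewrite h'K.
have h_index k v : v \in cycv dE k -> ((size (cycv dE k))%:Z %|
    ((index (h v) (cycv dF k))%:Z - (index v (cycv dE k))%:Z - al k)%R)%Z.
  by move=> /hP[_ /eqP]; rewrite eqz_mod_dvd opprD addrA.
rewrite !adjacencyE (eq_mxf (edge_count_perturbed dEP covE sP)).
rewrite (eq_mxf (edge_count_perturbed dFP covF tP)).
pose M := [seq (h' z.1, h' z.2) | z <- trail_pairs dF].
have cM : all (crossing (on_source_cycle dE)) M.
  rewrite all_map; apply: sub_all (trail_pairs_crossing dFP) => z.
  by rewrite /= /crossing /= !on_h.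
(* First move the trails of [E] onto the trails of [F] pulled back along [h], then relabel the
   vertices by [h]. *)
apply: (@sse_trans _ _ _ _ (mxf (perturbed s M))); last first.
  apply: (mxf_relabel (h := h)); first by exists h'.
  move=> v x; rewrite /perturbed (count_map_pair _ _ _ hK h'K) -hst.
  by rewrite (inj_eq (can_inj hK)).
rewrite -[trail_pairs dE]cats0 -[M]cats0.
apply: (match_pairs_sse (p := on_source_cycle dE)) => //.
- exact: cycle_partition_inj sP.
- by move=> v; apply: on_source_cycle_shift.
- exact: trail_pairs_crossing.
move=> [u x] /(crossing_classes covE)[i [j [ui xj]]].
rewrite !(eq_count (fun z => fconnect_in_class sP z ui xj)) (count_in_class_self
  _ _ _ vEP).
rewrite (count_in_class h'K size_eq h_mem (fun j => h_index (inr j)) vFP) /=.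
set c0 := (_ - _)%R; set c1 := (c0 + _)%R.
have g0 : ((cycle_gcd dE i j)%:Z != 0)%R.
  rewrite eqz_nat -lt0n gcdn_gt0 -!(size_map (@src _)).
  by case: sP => _ _ _ /(_ (inl i)) ->.
(* The counts are assumed equal only at natural numbers, so [c1] is replaced by its residue. *)
pose c2 := `|(c1 %% (cycle_gcd dE i j)%:Z)%Z|%N.
have c12 : ((cycle_gcd dE i j)%:Z %| (c1 - c2%:Z)%R)%Z.
  by rewrite -eqz_mod_dvd /c2 gez0_abs ?modz_ge0 // modz_mod.
rewrite (trail_count_mod _ c12) cnt; apply: trail_count_mod.
rewrite (cycle_gcd_eq _ _ size_eq).
have vi : h' (vF i) \in cycv dE (inl i) by rewrite -h_mem h'K; case: (vFP i).
have := dvd_gcd_source j (h_index _ _ vi); rewrite h'K /= => Dv.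
apply: (dvdz_lincomb (k := -1) (l := 1) c12 Dv).
by rewrite /c1 !intS; ring.
Qed.

(** * Renumbering the cycles *)

Section Renumbering.
Variables (E : graph) (m n m' n' : nat) (d : cycle_numbering E m n).
Variables (f : 'I_m' -> 'I_m) (g : 'I_n' -> 'I_n).
Hypotheses (fI : injective f) (gI : injective g).
Hypotheses (f_surj : forall i, exists i', f i' = i).
Hypotheses (g_surj : forall j, exists j', g j' = j).

(** The index types may differ, so two numberings can be compared before their numbers of cycles are
    known to be equal. *)
Definition renumber : cycle_numbering E m' n' :=
  CycleNumbering (source_cycle d \o f) (sink_cycle d \o g).

Lemma renumber_on_source v : on_source_cycle renumber v = on_source_cycle d v.
Proof.
apply/existsP/existsP => [[i vi]|[i vi]]; first by exists (f i).
by have [i' ii'] := f_surj i; exists i'; rewrite /= ii'.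
Qed.

Lemma renumber_on_sink v : on_sink_cycle renumber v = on_sink_cycle d v.
Proof.
apply/existsP/existsP => [[j vj]|[j vj]]; first by exists (g j).
by have [j' jj'] := g_surj j; exists j'; rewrite /= jj'.
Qed.

Lemma renumber_is_trail p : is_trail renumber p = is_trail d p.
Proof.
case: p => // e q; rewrite /= renumber_on_source renumber_on_sink.
do 3!congr (_ && _); apply: eq_all => e'.
by rewrite renumber_on_source renumber_on_sink.
Qed.

Lemma renumber_structure :
  source_sink_structure d -> source_sink_structure renumber.
Proof.
move=> dP; split=> /=.
- by have [[i /(leq_ltn_trans _)-> //]] := f_surj (Ordinal (source_count_gt0
    dP)).
- by have [[j /(leq_ltn_trans _)-> //]] := g_surj (Ordinal (sink_count_gt0 dP)).
- by move=> i; apply: source_cycleP.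
- by move=> j; apply: sink_cycleP.
- by move=> i i' v vi vi'; apply/fI/(source_source_disjoint dP vi vi').
- by move=> j j' v vj vj'; apply/gI/(sink_sink_disjoint dP vj vj').
- by move=> v; rewrite renumber_on_source renumber_on_sink;
    apply: source_sink_disjoint.
- move=> c /(all_cycles dP)[[i [k ->]]|[j [k ->]]].
    by have [i' <-] := f_surj i; left; exists i', k.
  by have [j' <-] := g_surj j; right; exists j', k.
- by move=> i e; apply: (source_no_entry dP).
- by move=> j e; apply: (sink_no_exit dP).
move=> v; rewrite renumber_on_source renumber_on_sink => vs vk.
have [u [w [us wk uv vw]]] := off_cycle_vertex dP vs vk.
by exists u, w; rewrite renumber_on_source renumber_on_sink.
Qed.

Lemma renumber_common_trail_source i v :
  is_common_trail_source d (f i) v -> is_common_trail_source renumber i v.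
Proof.
case=> vi [p [pt pv]] vuniq; split=> //.
  by exists p; split=> //; rewrite renumber_is_trail.
by move=> w q wi [qt qw]; apply: (vuniq w q) => //; split;
  rewrite // -renumber_is_trail.
Qed.

End Renumbering.

Lemma cycle_partition_reindex (V I J : finType) (c : I -> seq V) (c' : J ->
  seq V)
    (s : V -> V) (f : J -> I) :
  cycle_partition c s -> injective f -> (forall i, exists j, f j = i) ->
  (forall j, c' j = c (f j)) -> cycle_partition c' s.
Proof.
case=> cov dis U pos sE fI fS c'E; split=> [v|j j' v|j|j|j v]; rewrite ?c'E //.
- by have [i vi] := cov v; have [j ji] := fS i; exists j; rewrite c'E ji.
- by move=> vj vj'; apply/fI/(dis _ _ _ vj vj').
exact: sE.
Qed.

(** * From strong shift equivalence to trail counts *)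

Lemma common_trail_source_exists (E : graph) m n (d : cycle_numbering E m n) :
  connected E -> source_sink_structure d -> covers d ->
  (forall i v w p q,
      v \in cycle_vertices (source_cycle d i) ->
      w \in cycle_vertices (source_cycle d i) ->
      trail_starts_at d v p -> trail_starts_at d w q -> v = w) ->
  exists v, forall i, is_common_trail_source d i (v i).
Proof.
move=> conn dP cov same.
suff /fin_all_exists[v vP] i : exists v, is_common_trail_source d i v by exists
  v.
have [e ei et] := source_cycle_exit dP cov i conn.
have es : trail_starts_at d (src e) [:: e] by [].
exists (src e); split=> //; first by exists [:: e].
by move=> w p wi wp; apply: (same i w (src e) p [:: e]).
Qed.

Lemma cycle_partition_conjugate (V W I J : finType) (c : I ->
  seq V) (c' : J -> seq W)
    (s : V -> V) (t : W -> W) (h : V -> W) :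
  cycle_partition c s -> cycle_partition c' t -> injective h ->
  (forall v, h (s v) = t (h v)) ->
  forall k, exists k', forall v, (h v \in c' k') = (v \in c k).
Proof.
move=> cP cP' hI hst k; have hk j v : h (iter j s v) = iter j t (h v).
  by elim: j => //= j <-; rewrite hst.
have [v0 v0k] : exists v, v \in c k.
  case: cP => _ _ _ /(_ k); case: (c k) => // v q _ _.
  by exists v; rewrite mem_head.
case: (cP') => cov' _ _ _ _; have [k' hv0] := cov' (h v0).
exists k' => v; apply/idP/idP => [hv|vk].
  have [j] := cycle_partition_iter_exists cP' hv0 hv; rewrite -hk => /hI ->.
  by rewrite (cycle_partition_iter_mem cP).
have [j ->] := cycle_partition_iter_exists cP v0k vk.
by rewrite hk (cycle_partition_iter_mem cP').
Qed.

Lemma transfer_trail_counts (E F : graph) m n (dE : cycle_numbering E m n)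
    (dF : cycle_numbering F m n) vE vF s t h h' T :
  source_sink_structure dE ->
  covers dE -> cycle_partition (cycv dE) s -> cycle_partition (cycv dF) t ->
  (forall i, is_common_trail_source dE i (vE i)) ->
  (forall i, is_common_trail_source dF i (vF i)) ->
  cancel h h' -> cancel h' h -> (forall v, h (s v) = t (h v)) ->
  (forall k v, (h v \in cycv dF k) = (v \in cycv dE k)) ->
  (forall v x, on_source_cycle dE v -> ~~ on_source_cycle dE x ->
     T (s v) (s x) + count_mem (v, s x) (trail_pairs dE) =
     count_mem (h v, h (s x)) (trail_pairs dF) + T v x) ->
  (forall k, size (cycv dE k) = size (cycv dF k)) /\
  exists (a : 'I_m -> int) (b : 'I_n -> int), forall (c : nat) i j,
    trail_count dE vE i j c%:Z = trail_count dF vF i j (c%:Z + a i + b j)%R.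
Proof.
move=> dEP covE sP tP vEP vFP hK h'K hst h_mem TE.
have size_eq k : size (cycv dE k) = size (cycv dF k).
  have cardU (U : finType) (q : seq U) : uniq q ->
    size q = #|q| by move/card_uniqP.
  case: (sP) => _ _ U _ _; case: (tP) => _ _ U' _ _; rewrite !cardU //.
  rewrite -(card_image (can_inj hK)); apply: eq_card => w.
  by rewrite -(h'K w) (mem_image (can_inj hK)) h_mem.
split=> //.
have hk l v : h (iter l s v) = iter l t (h v).
  by elim: l => //= l <-; rewrite hst.
have [j|y yP] := @fin_all_exists _ (fun=> vertex E) (fun j y => y \in cycv dE
  (inr j)).
  case: sP => _ _ _ /(_ (inr j)); case: (cycv dE (inr j)) => // y q _ _.
  by exists y; rewrite mem_head.
(* As [h] commutes with the successors, it is a rotation on each sink cycle; its offset is measured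
   at an arbitrary vertex [y j]. *)
pose b j := ((index (h (y j)) (cycv dF (inr j)))%:Z
            - (index (y j) (cycv dE (inr j)))%:Z)%R.
pose a i := ((index (h' (vF i)) (cycv dE (inl i)))%:Z
            - (index (vE i) (cycv dE (inl i)))%:Z)%R.
exists a, b => c i j.
have h_index j' x : x \in cycv dE (inr j') -> ((size (cycv dE (inr j')))%:Z %|
    ((index (h x) (cycv dF (inr j')))%:Z - (index x (cycv dE (inr j')))%:Z - b
      j')%R)%Z.
  move=> /(cycle_partition_iter_exists sP (yP j'))[l ->]; rewrite hk.
  have hyP : h (y j') \in cycv dF (inr j') by rewrite h_mem.
  have := index_cycv_iter tP l hyP; rewrite -size_eq => D1.
  apply: (dvdz_lincomb (k := 1) (l := -1) D1 (index_cycv_iter sP l (yP j'))).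
  by rewrite /b; ring.
pose c0 := (c%:Z - (index (vE i) (cycv dE (inl i))).+1%:Z)%R.
have -> : (c%:Z)%R = (c0 + (index (vE i) (cycv dE (inl i))).+1%:Z)%R by rewrite
  subrK.
rewrite -count_in_class_self //.
have -> : (c0 + (index (vE i) (cycv dE (inl i))).+1%:Z + a i + b j)%R =
    (c0 + (index (h' (vF i)) (cycv dE (inl i))).+1%:Z + b j)%R.
  by rewrite /a !intS; ring.
rewrite -(count_in_class h'K size_eq h_mem h_index vFP).
apply: (count_transfer (s := s) (h := h) (T := T)) => //.
- exact: cycle_partition_inj sP.
- by move=> v x; apply: in_class_shift.
(* The class puts [s x] on a sink cycle, hence [x] is not on a source cycle and [TE] applies. *)
move=> v x /and3P[/= vi xj _]; apply: TE; first by apply/on_sourceP; exists i.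
apply/on_sourceP => -[i' xi']; rewrite -(cycle_partition_mem sP) in xi'.
by have := cycv_disjoint dEP xj xi'.
Qed.

Lemma sse_nf_equiv (E F : graph) : normal_form E -> normal_form F ->
  strong_shift_equivalent (adjacency E) (adjacency F) -> nf_equiv E F.
Proof.
move=> [[connE _ _] [m [n [dE [dEP trE sameE]]]]].
move=> [[connF _ _] [m' [n' [dF [dFP trF sameF]]]]].
have covE := single_edge_trails_cover dEP trE.
have covF := single_edge_trails_cover dFP trF.
have [vE vEP] := common_trail_source_exists connE dEP covE sameE.
have [vF vFP] := common_trail_source_exists connF dFP covF sameF.
have [s sP] := cycv_partition dEP covE; have [t tP] := cycv_partition dFP covF.
(* Every source vertex reaches an exit by going round its cycle, as the vanishing of the
   sink-to-source block requires. *)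
have exits (G : graph) k l (d : cycle_numbering G k l) r : connected G ->
    source_sink_structure d -> covers d -> cycle_partition (cycv d) r ->
    forall v, on_source_cycle d v -> exists j x, (iter j r v,
      x) \in trail_pairs d.
  move=> conn dP cov rP v /on_sourceP[i vi].
  have [e ei et] := source_cycle_exit dP cov i conn.
  have [j je] := cycle_partition_iter_exists rP vi ei.
  exists j, (rng e); rewrite -je; apply: (map_f (fun e => (src e, rng e))).
  by rewrite mem_filter et mem_enum.
rewrite !adjacencyE (eq_mxf (edge_count_perturbed dEP covE sP)).
rewrite (eq_mxf (edge_count_perturbed dFP covF tP)).
move/sse_shift_equivalent.
case/(@shift_equivalent_perturbed _ _ s t (on_source_cycle dE) (on_source_cycle
  dF)).
- exact: cycle_partition_inj sP.
- exact: cycle_partition_inj tP.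
- by move=> v; apply: on_source_cycle_shift.
- by move=> v; apply: on_source_cycle_shift.
- exact: trail_pairs_crossing.
- exact: trail_pairs_crossing.
- exact: exits.
- exact: exits.
move=> h [T [[h' hK h'K] hsrc hst TE]].
have hI := can_inj hK.
have conj := cycle_partition_conjugate sP tP hI hst.
have cycv_mem (G : graph) k l (d : cycle_numbering G k l) r x :
    cycle_partition (cycv d) r -> exists v, v \in cycv d x.
  case=> _ _ _ /(_ x); case: (cycv d x) => // v q _ _.
  by exists v; rewrite mem_head.
(* The conjugacy matches cycles with cycles and preserves their kind, which yields bijections of the
   source indices and of the sink indices. *)
have [i|f fP] := @fin_all_exists _ (fun=> 'I_m') (fun i i' =>
    forall v, (h v \in cycv dF (inl i')) = (v \in cycv dE (inl i))).
  have [[i'|j] kP] := conj (inl i); first by exists i'.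
  have [v vi] := cycv_mem _ _ _ _ _ (inl i) sP.
  have : on_source_cycle dF (h v) by rewrite hsrc; apply/on_sourceP; exists i.
  by move/(source_not_sink dFP)/on_sinkP => []; exists j; rewrite kP.
have [j|g gP] := @fin_all_exists _ (fun=> 'I_n') (fun j j' =>
    forall v, (h v \in cycv dF (inr j')) = (v \in cycv dE (inr j))).
  have [[i|j'] kP] := conj (inr j); last by exists j'.
  have [v vj] := cycv_mem _ _ _ _ _ (inr j) sP.
  have : on_source_cycle dE v by rewrite -hsrc; apply/on_sourceP; exists i;
    rewrite kP.
  by move/(source_not_sink dEP)/on_sinkP => []; exists j.
have fI : injective f.
  move=> i i' ii'; have [v vi] := cycv_mem _ _ _ _ _ (inl i) sP.
  by have := vi; rewrite -fP ii' fP => vi'; case: (cycv_disjoint dEP vi vi').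
have gI : injective g.
  move=> j j' jj'; have [v vj] := cycv_mem _ _ _ _ _ (inr j) sP.
  by have := vj; rewrite -gP jj' gP => vj'; case: (cycv_disjoint dEP vj vj').
have f_surj i' : exists i, f i = i'.
  have [w wi'] := cycv_mem _ _ _ _ _ (inl i') tP.
  have : on_source_cycle dE (h' w) by rewrite -hsrc h'K; apply/on_sourceP;
    exists i'.
  case/on_sourceP=> i; rewrite -fP h'K => wi; exists i.
  by case: (cycv_disjoint dFP wi wi').
have g_surj j' : exists j, g j = j'.
  have [w wj'] := cycv_mem _ _ _ _ _ (inr j') tP.
  have : on_sink_cycle dE (h' w).
    have := covE (h' w); rewrite -hsrc h'K orbC;
      case/orP=> // /(source_not_sink dFP).
    by case/on_sinkP; exists j'.
  case/on_sinkP=> j; rewrite -gP h'K => wj; exists j.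
  by case: (cycv_disjoint dFP wj wj').
pose dF' := renumber dF f g.
pose fg (k : 'I_m + 'I_n) := match k with inl i => inl (f i) |
  inr j => inr (g j) end.
have tP' : cycle_partition (cycv dF') t.
  apply: (cycle_partition_reindex (f := fg) tP) => [|[i'|j']|[i|j]] //.
  - by move=> [i|j] [i'|j'] // [] => [/fI|/gI] ->.
  - by have [i <-] := f_surj i'; exists (inl i).
  - by have [j <-] := g_surj j'; exists (inr j).
have trails : trail_pairs dF' = trail_pairs dF.
  by congr map; apply: eq_filter => e; apply: renumber_is_trail.
have vFP' i : is_common_trail_source dF' i (vF (f i)).
  exact: renumber_common_trail_source.
have h_mem k v : (h v \in cycv dF' k) = (v \in cycv dE k).
  by case: k => [i|j]; [apply: fP | apply: gP].
rewrite -trails in TE.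
have [size_eq [a [b cnt]]] :=
  transfer_trail_counts dEP covE sP tP' vEP vFP' hK h'K hst h_mem TE.
exists m, n, dE, dF', vE, (vF \o f), a, b; split=> //.
- by split=> //; apply: renumber_structure.
- by move=> i; rewrite -!(size_map (@src _)); apply: (size_eq (inl i)).
- by move=> j; rewrite -!(size_map (@src _)); apply: (size_eq (inr j)).
Qed.

(** The numberings in the equivalence need not be those witnessing normal form, so covering by
    cycles is carried over to them by [covers_transfer]. *)
Lemma nf_equiv_sse (E F : graph) : normal_form E -> normal_form F ->
  nf_equiv E F -> strong_shift_equivalent (adjacency E) (adjacency F).
Proof.
move=> [_ [mE [nE [d [dP trE _]]]]] [_ [mF [nF [d' [dP' trF _]]]]].
have covE := single_edge_trails_cover dP trE.
have covF := single_edge_trails_cover dP' trF.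
case=> m [n [dE [dF [vE [vF [a [b [[dEP dFP] vP p_eq q_eq cnt]]]]]]]].
apply: (trail_counts_sse dEP dFP _ _ (fun i => (vP i).1) (fun i => (vP i).2) _
  cnt).
- exact: covers_transfer covE.
- exact: covers_transfer covF.
by case=> [i|j]; rewrite /cycv /cycle_vertices !size_map;
  [apply: p_eq | apply: q_eq].
Qed.

Theorem theorem3p12 (E F E' F' : graph)
    (hE : gk_dim_three E) (hF : gk_dim_three F)
    (hE' : normal_form E') (hF' : normal_form F')
    (hEE' : obtained_from E' E) (hFF' : obtained_from F' F) :
  strong_shift_equivalent (adjacency E) (adjacency F) <-> nf_equiv E' F'.
Proof.
have EE' := obtained_from_sse hEE'; have FF' := obtained_from_sse hFF'.
split=> [EF|/(nf_equiv_sse hE' hF') EF'].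
  by apply: sse_nf_equiv => //; apply: sse_trans (sse_sym EE') (sse_trans EF
    FF').
exact: sse_trans EE' (sse_trans EF' (sse_sym FF')).
Qed.
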